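(* Let $(\mathcal{A},\varphi)$ be a noncommutative probability space and let $\{h_n\colon \mathcal{A}^n\to\mathbb{C}\}_{n\geq 1}$ be the family of monotone cumulants of $(\mathcal{A},\varphi)$. Then, for any $n\geq 1$ and $a_1,\dots,a_n\in\mathcal{A}$, $$h_n(a_1,\dots,a_n)=\sum_{\pi\in\mathrm{NC}(n)}\alpha(\pi)\,\varphi_\pi(a_1,\dots,a_n),$$ where $$\alpha(\pi)=\sum_{\substack{t\in\mathrm{ST}(n)\\ \pi(t)=\pi}}\omega(\mathrm{sk}(t))\qquad\text{for all }\pi\in\mathrm{NC}(n).$$
   Context: Noncommutative probability space: a pair $(\mathcal{A},\varphi)$ with $\mathcal{A}$ a unital (associative) algebra over $\mathbb{C}$ and $\varphi\colon\mathcal{A}\to\mathbb{C}$ linear with $\varphi(1_{\mathcal{A}})=1$. Put $\varphi_n(a_1,\dots,a_n)=\varphi(a_1\cdots a_n)$ (product in $\mathcal{A}$). Noncrossing partitions: $\mathrm{NC}(n)$ is the set of set partitions $\pi$ of $[n]=\{1,\dots,n\}$ such that there are no $a<b<c<d$ with $a,c$ in one block and $b,d$ in another, different block. For a family of multilinear functionals $\{f_n\colon\mathcal{A}^n\to\mathbb{C}\}_{n\ge1}$ and $\pi\in\mathrm{NC}(n)$, set $f_\pi(a_1,\dots,a_n)=\prod_{V\in\pi}f_{|V|}(a_1,\dots,a_n|V)$, where for $V=\{i_1<\dots<i_s\}$, $f_{|V|}(a_1,\dots,a_n|V)=f_s(a_{i_1},\dots,a_{i_s})$. In particular $\varphi_\pi$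 is obtained from $\{\varphi_n\}$. Forest of nestings: for blocks $V,W$ of $\pi\in\mathrm{NC}(n)$ write $V\le W$ if every element of $W$ lies in the interval $[\min V,\max V]$. The forest of nestings $t(\pi)$ is the forest of rooted trees whose vertices are the blocks of $\pi$, with an edge from $V$ to $W$ (so $W$ is a child of $V$) iff $V<W$ and there is no block $U$ with $V<U<W$; the roots are the minimal blocks. Tree factorial: $t!=1$ if $t$ is a single vertex; if $t$ is obtained by grafting subtrees $s_1,\dots,s_m$ to a root, $t!=|t|\,s_1!\cdots s_m!$, where $|t|$ is the number of vertices; for a forest, $f!$ is the product of the factorials of its trees. Monotone cumulants: the multilinear functionals $\{h_n\colon\mathcal{A}^n\to\mathbb{C}\}_{n\ge1}$ defined recursively by $\varphi_n(a_1,\dots,a_n)=\sum_{\pi\in\mathrm{NC}(n)}\frac{1}{t(\pi)!}h_\pi(a_1,\dots,a_n)$ for all $n\ge1$ and $a_i\in\mathcal{A}$. Schröder trees: planar rooted trees in which every internal (non-leaf) vertex has at least two children; $\mathrm{ST}(n)$ is the set of those with $n+1$ leaves. Partition $\pi(t)$: for $t\in\mathrm{ST}(n)$ label the $n$ sectors between consecutive leaves, from left to right, by $1,\dots,n$. For each internal vertex $v$, consider the corolla formed by $v$ and its children; the sectors between consecutive children of $v$ form a block of $\pi(t)$ (equivalently, $i$ is in the block of $v$ iff $v$ is the last common ancestor of the $i$-th and $(i+1)$-st leaves). Then $\pi(t)\in\mathrm{NC}(n)$, with one block for each internal vertex. Skeleton: $\mathrm{sk}(t)$ is the planar rooted tree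 whose vertices are the internal vertices of $t$, with $w$ a child of $v$ in $\mathrm{sk}(t)$ iff $w$ is a child of $v$ in $t$. Murua coefficients: a rooted tree $s$ is viewed as a poset with $v<w$ iff $v\neq w$ and $v$ lies on the path from the root to $w$. For a rooted tree $s$ with $|s|$ vertices and $1\le k\le|s|$, $\omega_k(s)$ is the number of surjective functions $f\colon s\to\{1,\dots,k\}$ such that $v<w$ implies $f(v)<f(w)$; and $\omega(s)=\sum_{k=1}^{|s|}\frac{(-1)^{k+1}}{k}\omega_k(s)$. *)

(* Defs.v *)
From HB Require Import structures.
From mathcomp Require Import all_boot all_order all_algebra.
From mathcomp Require Import zify.
From mathcomp Require Export reals.
From mathcomp Require Export complex.

Set Implicit Arguments.
Unset Strict Implicit.
Unset Printing Implicit Defensive.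

Import Order.TTheory GRing.Theory Num.Theory.
Local Open Scope ring_scope.

(** * Planar rooted trees *)

(* [PNode [::]] is the single-vertex tree.  Non-planar rooted trees are
   represented by an arbitrary planar embedding: the tree factorial and the
   Murua coefficients below do not depend on the order of the children. *)
Inductive ptree := PNode of seq ptree.

Definition children (t : ptree) : seq ptree := let: PNode ts := t in ts.

Section PtreeInd.
Variable K : ptree -> Prop.
Hypothesis K_node : forall ts, (forall i, (i < size ts)%N ->
  K (nth (PNode [::]) ts i)) -> K (PNode ts).

Fixpoint ptree_nested_ind (t : ptree) : K t :=
  let: PNode ts := t in K_node
    ((fix all_K (ts : seq ptree) : forall i, (i < size ts)%N ->
        K (nth (PNode [::]) ts i) :=
      match ts with
      | [::] => fun i (lt_i0 : (i < 0)%N) => False_ind _ (notF lt_i0)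
      | u :: us => fun i => match i with
          | 0 => fun _ => ptree_nested_ind u
          | j.+1 => fun lt_j => all_K us j lt_j
          end
      end) ts).
End PtreeInd.

Fixpoint ptree_encode (t : ptree) : GenTree.tree unit :=
  let: PNode ts := t in GenTree.Node 0 (map ptree_encode ts).

Fixpoint ptree_decode (t : GenTree.tree unit) : ptree :=
  if t is GenTree.Node _ ts then PNode (map ptree_decode ts) else PNode [::].

Lemma ptree_encodeK : cancel ptree_encode ptree_decode.
Proof.
elim/ptree_nested_ind => ts IH /=; rewrite -map_comp; congr PNode.
apply: (@eq_from_nth _ (PNode [::])); rewrite size_map // => i lt_i.
by rewrite (nth_map (PNode [::])) //= IH.
Qed.

HB.instance Definition _ := Countable.copy ptree (can_type ptree_encodeK).

Lemma ptree_mem_ind (K : ptree -> Prop) :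
  (forall ts, (forall t, t \in ts -> K t) -> K (PNode ts)) -> forall t, K t.
Proof.
move=> IH; elim/ptree_nested_ind => ts Kts; apply: IH => t t_ts.
by rewrite -(nth_index (PNode [::]) t_ts); apply: Kts; rewrite index_mem.
Qed.

Definition is_leaf (t : ptree) : bool := nilp (children t).

Fixpoint nleaves (t : ptree) : nat :=
  let: PNode ts := t in if nilp ts then 1 else sumn (map nleaves ts).

Fixpoint nvertices (t : ptree) : nat :=
  let: PNode ts := t in (sumn (map nvertices ts)).+1.

Fixpoint tree_factorial (t : ptree) : nat :=
  let: PNode ts := t in
  (nvertices t * \prod_(m <- map tree_factorial ts) m)%N.

Definition forest_factorial (f : seq ptree) : nat :=
  (\prod_(t <- f) tree_factorial t)%N.

(* Vertices are given by their addresses: the root is [[::]], and [j :: p] is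
   the vertex [p] of the subtree at the [j]-th child of the root.  Thus [p]
   lies on the path from the root to [q] iff [p] is a prefix of [q]. *)
Fixpoint vertices (t : ptree) : seq (seq nat) :=
  let: PNode ts := t in
  let vs := map vertices ts in
  [::] :: flatten [seq map (cons p.1) p.2 | p <- zip (iota 0 (size vs)) vs].

Definition vertex (t : ptree) := seq_sub (vertices t).

Definition vertex_lt (t : ptree) (v w : vertex t) : bool :=
  (v != w) && prefix (val v) (val w).

(** * Murua coefficients *)

Definition strict_surjection (s : ptree) (k : nat)
    (f : {ffun vertex s -> 'I_k}) : bool :=
  [forall c, exists v, f v == c] &&
  [forall v, forall w, vertex_lt v w ==> (f v < f w)%N].

Definition murua_count (k : nat) (s : ptree) : nat :=
  #|[set f : {ffun vertex s -> 'I_k} | strict_surjection f]|.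

Definition murua (s : ptree) : rat :=
  \sum_(1 <= k < (nvertices s).+1)
    (-1) ^+ k.+1 / k%:R * (murua_count k s)%:R.

(** * Schroeder trees *)

Fixpoint schroeder (t : ptree) : bool :=
  let: PNode ts := t in (size ts != 1)%N && all schroeder ts.

Record schroeder_tree (n : nat) := SchroederTree {
  stree :> ptree;
  streeP : schroeder stree && (nleaves stree == n.+1) }.

HB.instance Definition _ n := [isSub for @stree n].
HB.instance Definition _ n := [Countable of schroeder_tree n by <:].

(* The trees of height at most [h] whose vertices have at most [m] children. *)
Definition seqs_upto (T : Type) (m : nat) (s : seq T) : seq (seq T) :=
  iter m (fun r => [::] :: [seq x :: u | x <- s, u <- r]) [:: [::]].

Definition bounded_trees (m h : nat) : seq ptree :=
  iter h (fun r => map PNode (seqs_upto m r)) [:: PNode [::]].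

Lemma mem_seqs_upto (T : eqType) (m : nat) (s u : seq T) :
  (size u <= m)%N -> {subset u <= s} -> u \in seqs_upto m s.
Proof.
elim: m u => [|m IH] [|x u] //= le_um sub_us; rewrite inE orFb.
apply: allpairs_f; first by rewrite sub_us ?mem_head.
by apply: IH => // y y_u; rewrite sub_us // inE y_u orbT.
Qed.

Lemma nleaves_gt0 t : (0 < nleaves t)%N.
Proof.
elim/ptree_mem_ind: t => [[|t ts]] //= IH.
by rewrite addn_gt0 IH // mem_head.
Qed.

Lemma leq_size_sumn (s : seq nat) :
  all (fun i => 0 < i)%N s -> (size s <= sumn s)%N.
Proof. by elim: s => //= i s IH /andP[i_gt0 /IH]; rewrite -add1n; apply: leq_add. Qed.

Lemma mem_bounded_trees m h t :
    schroeder t -> (nleaves t <= m)%N -> (nleaves t <= h.+1)%N ->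
  t \in bounded_trees m h.
Proof.
elim: h t => [|h IH] [ts] /= /andP[ts_n1 /allP sch_ts].
  case: ts ts_n1 sch_ts => [|u [|v us]] //= _ _ _.
  by have:= nleaves_gt0 u; have:= nleaves_gt0 v; lia.
move=> le_m le_h; apply/map_f/mem_seqs_upto.
  case: ts {ts_n1 sch_ts le_h} le_m => [|u us] //=; apply: leq_trans.
  rewrite -[(size us).+1]/(size (u :: us)) -(size_map nleaves).
  by apply: leq_size_sumn; apply/allP => _ /mapP[t _ ->]; apply: nleaves_gt0.
move=> t t_ts; have sch_t: schroeder t by apply: sch_ts.
have lt_t: (nleaves t < nleaves (PNode ts))%N.
  case/splitPr: t_ts ts_n1 {sch_ts le_m le_h} => us vs.
  rewrite /nilp size_cat /= addnS /= map_cat sumn_cat /=.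
  case: us vs => [|u us] [|v vs] //= _.
  - by have:= nleaves_gt0 v; lia.
  - by have:= nleaves_gt0 u; lia.
  - by have:= nleaves_gt0 u; lia.
apply: IH => //; first exact: leq_trans (ltnW lt_t) le_m.
exact: leq_trans lt_t le_h.
Qed.

Fact schroeder_tree_finite n : Finite.axiom
  (pmap insub (undup (bounded_trees n.+1 n)) : seq (schroeder_tree n)).
Proof.
apply: Finite.uniq_enumP => [|t].
  by rewrite pmap_sub_uniq ?undup_uniq.
rewrite mem_pmap_sub mem_undup inE.
by case: t => t /= /andP[sch_t /eqP nl_t]; apply: mem_bounded_trees; rewrite ?nl_t.
Qed.

HB.instance Definition _ n := isFinite.Build (schroeder_tree n)
  (@schroeder_tree_finite n).

Fixpoint skeleton (t : ptree) : ptree :=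
  let: PNode ts := t in
  PNode (pmap (fun u => if is_leaf u then None else Some (skeleton u)) ts).

(* The sectors of [t] from left to right, each given by the address of the
   internal vertex at which it lies: the sector between the subtrees at two
   consecutive children of the root belongs to the root [[::]]. *)
Fixpoint sectors (t : ptree) : seq (seq nat) :=
  let: PNode ts := t in
  let ss := map sectors ts in
  behead (flatten
    [seq [::] :: map (cons p.1) p.2 | p <- zip (iota 0 (size ss)) ss]).

(** * Noncrossing partitions *)

Definition noncrossing (n : nat) (P : {set {set 'I_n}}) : bool :=
  [forall V in P, forall W in P,
   forall a in V, forall b in W, forall c in V, forall d in W,
     (a < b < c)%N && (c < d)%N ==> (V == W)].

Definition NC (n : nat) : {set {set {set 'I_n}}} :=
  [set P | partition P [set: 'I_n] && noncrossing P].

(* [preim_partition f D] is the partition of [D] into the nonempty fibres of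
   [f]: two sectors are in the same block iff they lie at the same vertex. *)
Definition tree_partition (n : nat) (t : schroeder_tree n) :
    {set {set 'I_n}} :=
  preim_partition (fun i : 'I_n => nth [::] (sectors t) i) [set: 'I_n].

(** * Forest of nestings *)

Section Nestings.
Variables (n : nat) (P : {set {set 'I_n}}).
Implicit Types V W U : {set 'I_n}.

Definition block_min V : nat := \big[minn/n]_(i in V) (i : nat).
Definition block_max V : nat := (\max_(i in V) i)%N.

Definition nest_le V W : bool :=
  [forall i in W, (block_min V <= i <= block_max V)%N].
Definition nest_lt V W : bool := (V != W) && nest_le V W.

Definition nest_children V : {set {set 'I_n}} :=
  [set W in P | nest_lt V W && ~~ [exists U in P, nest_lt V U && nest_lt U W]].
Definition nest_roots : {set {set 'I_n}} :=
  [set V in P | ~~ [exists U in P, nest_lt U V]].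

(* The number of iterations only has to be large enough: see [nest_treeE]. *)
Fixpoint nest_tree_rec (k : nat) V : ptree :=
  if k is k'.+1 then PNode (map (nest_tree_rec k') (enum (nest_children V)))
  else PNode [::].
Definition nest_tree V : ptree := nest_tree_rec #|P| V.

Definition nest_forest : seq ptree := map nest_tree (enum nest_roots).

Hypothesis partP : partition P [set: 'I_n].

Lemma block_minP V i : i \in V -> (block_min V <= i)%N.
Proof.
move=> Vi; have := mem_index_enum i; rewrite /block_min.
elim: (index_enum _) => //= j r IH; rewrite inE big_cons => /predU1P[<-|/IH le_i].
  by rewrite Vi geq_minl.
by case: ifP => // _; rewrite geq_min le_i orbT.
Qed.

Lemma block_maxP V i : i \in V -> (i <= block_max V)%N.
Proof.
by move=> Vi; apply: (@leq_bigmax_cond _ [in V] (fun j : 'I_n => j : nat)).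
Qed.

Lemma block_min_in V : V \in P -> exists2 i, i \in V & block_min V = i :> nat.
Proof.
move=> PV; have/set0Pn[i Vi]: V != set0.
  by case/and3P: partP => _ _; apply: contraNneq => <-.
rewrite /block_min; case: (arg_minnP (fun j : 'I_n => j : nat) Vi) => j Vj minj.
exists j => //; apply/eqP; rewrite eqn_leq block_minP //=.
rewrite -/(block_min V) /block_min.
apply: (big_ind (fun m => j <= m)%N); first exact: ltnW.
  by move=> x y; rewrite leq_min => -> ->.
exact: minj.
Qed.

Lemma nest_lt_trans U V W :
  U \in P -> V \in P -> W \in P -> nest_lt U V -> nest_lt V W -> nest_lt U W.
Proof.
move=> PU PV PW /andP[UnV /forall_inP UV] /andP[VnW /forall_inP VW].
have VUmin i : i \in V -> (block_min U <= i <= block_max U)%N by apply: UV.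
have minUV : (block_min U <= block_min V)%N.
  by have [i Vi ->] := block_min_in PV; case/andP: (UV i Vi).
have maxUV : (block_max V <= block_max U)%N.
  by apply/bigmax_leqP => i /UV/andP[].
apply/andP; split; last first.
  apply/forall_inP => i /VW/andP[le1 le2].
  by rewrite (leq_trans minUV) ?(leq_trans le2).
apply: contraNneq VnW => UW; rewrite -UW in VW *.
have [i Ui mini] := block_min_in PU; have [j Vj minj] := block_min_in PV.
have ij : i = j.
  apply: val_inj => /=; case/andP: (VW i Ui) => le_ji _.
  by case/andP: (UV j Vj) => le_ij _; lia.
have tP : trivIset P by case/and3P: partP.
by rewrite -(def_pblock tP PU Ui) ij (def_pblock tP PV Vj).
Qed.

Lemma nest_treeE V : V \in P ->
  nest_tree V = PNode (map nest_tree (enum (nest_children V))).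
Proof.
pose above V := [set W in P | nest_lt V W].
have above_lt U W : W \in P -> U \in nest_children W ->
    (#|above U| < #|above W|)%N.
  move=> PW; rewrite inE => /and3P[PU WU _]; apply: proper_card.
  apply/properP; split; last by exists U; rewrite !inE PU /nest_lt ?eqxx.
  apply/subsetP => X; rewrite !inE => /andP[PX UX]; rewrite PX.
  exact: nest_lt_trans UX.
have stable k l W : W \in P -> (#|above W| <= k)%N -> (#|above W| <= l)%N ->
    nest_tree_rec k W = nest_tree_rec l W.
  elim: k l W => [|k IH] [|l] W PW //= le_k le_l.
  - case: (set_0Vmem (nest_children W)) => [->|[U /(above_lt _ _ PW)]].
      by rewrite enum_set0.
    by rewrite ltnNge (leq_trans le_k).
  - case: (set_0Vmem (nest_children W)) => [->|[U /(above_lt _ _ PW)]].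
      by rewrite enum_set0.
    by rewrite ltnNge (leq_trans le_l).
  congr PNode; apply/eq_in_map => U; rewrite mem_enum => chU.
  have lt_U := above_lt _ _ PW chU.
  apply: IH; first by move: chU; rewrite inE => /andP[].
    by rewrite -ltnS (leq_trans lt_U).
  by rewrite -ltnS (leq_trans lt_U).
move=> PV; have le_above W : (#|above W| <= #|P|)%N.
  by apply/subset_leq_card/subsetP => U; rewrite inE => /andP[].
rewrite /nest_tree (stable _ #|P|.+1 V) // ?leqW //.
Qed.
End Nestings.

(** * Moments and monotone cumulants *)

Section Cumulants.
Variables (R : realType) (A : algType R[i]).

Definition functionals := forall n, {ffun 'I_n -> A} -> R[i].

Definition multilinear (n : nat) (f : {ffun 'I_n -> A} -> R[i]) : Prop :=
  forall (a : {ffun 'I_n -> A}) (i : 'I_n),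
    scalar (fun x : A => f [ffun j => if j == i then x else a j]).

(* [enum_val] lists the elements of [V] in increasing order. *)
Definition restrict (n : nat) (a : {ffun 'I_n -> A}) (V : {set 'I_n}) :
  {ffun 'I_#|V| -> A} := [ffun j => a (enum_val j)].

Definition part_functional (f : functionals) (n : nat) (P : {set {set 'I_n}})
    (a : {ffun 'I_n -> A}) : R[i] :=
  \prod_(V in P) f #|V| (restrict a V).

Definition moments (phi : A -> R[i]) : functionals :=
  fun n a => phi (\prod_(i < n) a i).

(* The one-block partition contributes [h n a] itself, so the formula determines
   [h n] from the [h m] with [m < n]; the value [h 0] is unconstrained. *)
Definition monotone_cumulants (phi : A -> R[i]) (h : functionals) : Prop :=
  (forall n, (0 < n)%N -> multilinear (h n)) /\
  (forall n, (0 < n)%N -> forall a : {ffun 'I_n -> A},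
     moments phi a =
     \sum_(P in NC n)
       (forest_factorial (nest_forest P))%:R^-1 * part_functional h P a).

End Cumulants.

Definition alpha (n : nat) (P : {set {set 'I_n}}) : rat :=
  \sum_(t : schroeder_tree n | tree_partition t == P) murua (skeleton t).

(* Main.v *)
Require Import Defs.
From mathcomp Require Import all_boot all_order all_algebra.
From mathcomp Require Import zify.

(** Call a function [l] from [n] points to [k] levels a level function.  Two
    points belong to the same level block when they have the same level and no
    point between them has a smaller one; the level blocks form a noncrossing
    partition [pi(l)].  The theorem comes from evaluating, in two ways,
    [N_k = \sum_l phi_(pi(l))(a)], the sum over all level functions with [k]
    levels.  (In Hopf-algebraic terms [N_k] is the value at the word [a] of the
    [k]-th convolution power of the character [phi], monotone cumulants are the
    logarithm of that character, and the argument below reads the logarithm off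
    the powers as the coefficient of [k] in the polynomial [N_k].)

    On the cumulant side, expand each moment in [phi_(pi(l))] into cumulants.
    This gives a sum over the noncrossing partitions [P] that refine [pi(l)],
    and for a given [P] the admissible [l] are the level functions that are
    constant on the blocks of [P] and weakly increasing along nesting.  The tree
    factorial is a hook product, the product over the blocks [B] of the number of
    blocks nested in [B] ([forest_factorial_hooks]), and hook products satisfy a
    binomial theorem over down-closed sets ([hooks_binomial_exp]).  Summing the
    inverse hook products level by level then gives ([sum_levels_moments])
      [N_k = \sum_(P in NC n) k ^ #|P| / t(P)! * h_P(a)],
    a polynomial in [k] whose coefficient of degree one is [h_n(a)], as the
    one-block partition is the only one with a single block.

    On the moment side, group the level functions by their image, whose position
    among the [k] levels does not matter: [N_k = \sum_j 'C(k, j) * U_j], where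
    [U_j] sums over the level functions onto [j] levels.  The coefficient of [k]
    in ['C(k, j)] is [(-1) ^ (j + 1) / j], whence
      [h_n(a) = \sum_j (-1) ^ (j + 1) / j * U_j]   ([cumulant_surjective_sums]).

    Finally, a level function is the same thing as a Schroeder tree whose
    internal vertices carry strictly increasing labels: each point takes the
    label of the vertex at which its sector lies, and the tree is recovered as
    the Cartesian tree of the word of levels, cutting at all the occurrences of
    the smallest letter ([cartesian_tree_sectors], [cartesian_treeP]).  Under
    this bijection [pi(l)] is the partition of the tree ([level_treeP]), so [U_j]
    counts each tree [t] as often as there are strict surjections from its
    skeleton onto [j] levels ([sum_trees_levels]), and the alternating sum over
    [j] produces the Murua coefficients. *)

Set Implicit Arguments.
Unset Strict Implicit.
Unset Printing Implicit Defensive.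
Import Order.TTheory GRing.Theory Num.Theory.
Local Open Scope ring_scope.

(** * Hook products on finite forests *)

Section Hooks.
Variables (T : finType) (le : rel T) (P : {set T}).
Hypothesis le_refl : reflexive le.
Hypothesis le_anti : {in P &, antisymmetric le}.
Hypothesis le_trans : forall x y z, x \in P -> y \in P -> z \in P ->
  le x y -> le y z -> le x z.
Hypothesis le_forest : forall x y z, x \in P -> y \in P -> z \in P ->
  le x z -> le y z -> le x y || le y x.
Implicit Types (F I : {set T}) (x y : T).

Definition up F x := [set y in F | le x y].
(** For the poset of vertices of a forest, rooted at the minimal elements, this
    is the forest factorial. *)
Definition hooks F := (\prod_(x in F) #|up F x|)%N.
Definition down_closed F I :=
  (I \subset F) && [forall x in I, forall y in F, le y x ==> (y \in I)].
Definition minimals F := [set x in F | [forall y in F, le y x ==> (y == x)]].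

(** Existence needs only finiteness; uniqueness is where the forest hypothesis
    enters: two minimal elements below [y] are comparable, hence equal. *)
Lemma minimal_below F y : F \subset P -> y \in F ->
  #|[set x in minimals F | le x y]| = 1%N.
Proof.
move=> /subsetP sFP yF; apply/eqP/cards1P.
have y0 : (y \in F) && le y y by rewrite yF le_refl.
(* An element below [y] whose up-set is largest is minimal. *)
case: (@arg_maxnP _ y (fun x => (x \in F) && le x y) (fun x => #|up F x|) y0).
move=> x /andP[xF lexy] xmax; exists x.
have xmin z : z \in F -> le z x -> z = x.
  move=> zF lezx; have lezy : le z y by apply: (@le_trans _ x); rewrite ?sFP.
  have sub : up F x \subset up F z.
    apply/subsetP => u; rewrite !inE => /andP[uF lexu].
    by rewrite uF; apply: (@le_trans _ x); rewrite ?sFP.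
  have /eqP eq_up : up F x == up F z by rewrite eqEcard sub; apply: xmax; rewrite zF.
  have : z \in up F x by rewrite eq_up inE zF le_refl.
  rewrite inE => /andP[_ lexz]; apply: le_anti; rewrite ?sFP //.
  by rewrite lezx lexz.
apply/setP => z; rewrite !inE; apply/andP/eqP => [[/andP[zF /forall_inP zmin] lezy]|->].
  have /orP[lexz|/xmin->//] := le_forest (sFP _ xF) (sFP _ zF) (sFP _ yF) lexy lezy.
  by apply/esym/eqP; apply: (implyP (zmin _ xF)).
split=> //; rewrite xF; apply/forall_inP => u uF; apply/implyP => /xmin->//.
Qed.

(** A forest is the disjoint union of the trees hanging from its roots; this is
    used with sums for sizes and with products for factorials. *)
Lemma big_up_minimals (R : Type) (idx : R) (op : Monoid.com_law idx) F (G : T -> R) :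
  F \subset P ->
  \big[op/idx]_(x in minimals F) \big[op/idx]_(y in up F x) G y
  = \big[op/idx]_(y in F) G y.
Proof.
move=> sFP; rewrite (exchange_big_dep (mem F)) /=; last first.
  by move=> x y _; rewrite inE => /andP[].
apply: eq_bigr => y yF.
have /eqP/cards1P[x0 E] := minimal_below sFP yF.
rewrite (big_pred1 x0) // => x.
by rewrite /= -in_set1 -E [x \in [set _ in _ | _]]inE [y \in up _ _]inE yF.
Qed.

Lemma sum_up_minimals F : F \subset P ->
  (\sum_(x in minimals F) #|up F x| = #|F|)%N.
Proof.
move=> sFP; rewrite -sum1_card -[RHS]big_up_minimals //.
by apply: eq_bigr => x _; rewrite sum1_card.
Qed.

Lemma hooksD1 F x : x \in minimals F ->
  hooks F = (#|up F x| * hooks (F :\ x))%N.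
Proof.
rewrite inE => /andP[xF /forall_inP xmin].
rewrite /hooks (big_setD1 x) //=; congr (_ * _)%N; apply: eq_bigr => y.
rewrite 2!inE => /andP[yx yF]; congr #|pred_of_set _|; apply/setP => z.
rewrite !inE; case: eqP => //= ->; rewrite xF /=; apply/negP => leyx.
by have := implyP (xmin _ yF) leyx; rewrite (negPf yx).
Qed.

Lemma minimals_down F I : down_closed F I -> minimals I = I :&: minimals F.
Proof.
case/andP=> /subsetP sIF /forall_inP dI; apply/setP => x; rewrite !inE.
case xI: (x \in I) => //=; rewrite (sIF _ xI) /=.
apply/forall_inP/forall_inP => H y.
  move=> yF; apply/implyP => lyx; have := forall_inP (dI _ xI) _ yF.
  by rewrite lyx => /= yI; have := H _ yI; rewrite lyx.
by move=> /sIF; apply: H.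
Qed.

Lemma down_closedD1 F I x : x \in minimals F -> x \in I ->
  down_closed F I = down_closed (F :\ x) (I :\ x).
Proof.
rewrite inE => /andP[xF /forall_inP xmin] xI.
apply/andP/andP => -[/subsetP sIF /forall_inP dI]; split.
- by apply/subsetP => y; rewrite !inE => /andP[-> /sIF].
- apply/forall_inP => y; rewrite !inE => /andP[yx yI].
  apply/forall_inP => z; rewrite !inE => /andP[-> zF]; exact: (forall_inP (dI _ yI)).
- apply/subsetP => y yI; case: (eqVneq y x) => [->//|yx].
  by have := sIF y; rewrite !inE yx yI => /(_ isT).
- apply/forall_inP => y yI; apply/forall_inP => z zF; apply/implyP => lezy.
  case: (eqVneq z x) => [->//|zx]; case: (eqVneq y x) => [yx|yx].
    by have := implyP (xmin _ zF); rewrite -yx lezy => /(_ isT)/eqP->.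
  have := dI y; rewrite !inE yx yI => /(_ isT)/forall_inP/(_ z).
  by rewrite !inE zx zF lezy => /(_ isT).
Qed.

Variable K : numFieldType.

Lemma up_minimals_neq0 F x : x \in minimals F -> #|up F x|%:R != 0 :> K.
Proof.
rewrite inE => /andP[xF _]; rewrite pnatr_eq0 -lt0n.
by apply/card_gt0P; exists x; rewrite inE xF le_refl.
Qed.

(** The hooks of the roots partition the forest, so their lengths add up to
    [#|F|]; removing a root divides the hook product by its hook length.  This
    is the recursion that makes the binomial theorem below work. *)
Lemma sum_inv_hooksD1 F : F \subset P ->
  \sum_(x in minimals F) (hooks (F :\ x))%:R^-1 = #|F|%:R / (hooks F)%:R :> K.
Proof.
move=> sFP; rewrite -(sum_up_minimals sFP) natr_sum mulr_suml.
apply: eq_bigr => x xm; rewrite (hooksD1 xm) natrM.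
by rewrite invfM mulrA divff ?mul1r // up_minimals_neq0.
Qed.

(** Induction on [m]: multiplying by [m.+1] amounts to choosing a root of [I]
    and deleting it, since [I] is itself a forest with [m.+1] vertices.  The roots
    of a down-closed [I] are roots of [F], so the two sums can be exchanged, and
    what remains is the case of [m] for [F] minus a root. *)
Lemma hooks_binomial F m : F \subset P ->
  \sum_(I : {set T} | down_closed F I && (#|I| == m))
      (hooks I)%:R^-1 / (hooks (F :\: I))%:R
  = 'C(#|F|, m)%:R / (hooks F)%:R :> K.
Proof.
elim: m F => [|m IH] F sFP.
  rewrite (big_pred1 set0) => [|I].
    by rewrite /hooks big_set0 setD0 bin0 invr1.
  rewrite cards_eq0 andbC /=; case: eqP => //= ->; rewrite /down_closed sub0set.
  by apply/forall_inP => x; rewrite inE.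
have m1 : m.+1%:R != 0 :> K by rewrite pnatr_eq0.
apply: (mulfI m1); rewrite mulrA -natrM -mul_bin_diag natrM.
transitivity (\sum_(I : {set T} | down_closed F I && (#|I| == m.+1))
   \sum_(x in I :&: minimals F) (hooks (I :\ x))%:R^-1 / (hooks (F :\: I))%:R : K).
  rewrite mulr_sumr; apply: eq_bigr => I /andP[dI /eqP cI].
  rewrite -(minimals_down dI) -mulr_suml sum_inv_hooksD1 ?cI ?mulrA //.
  by apply: subset_trans sFP; case/andP: dI.
rewrite (exchange_big_dep (mem (minimals F))) /=; last first.
  by move=> I x _ /setIP[].
rewrite mulrAC -sum_inv_hooksD1 // mulr_suml; apply: eq_bigr => x xm.
rewrite (reindex_onto (fun J => x |: J) (fun I => I :\ x)) /=; last first.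
  by move=> I /andP[_ /setIP[xI _]]; rewrite setD1K.
have xF : x \in F by move: xm; rewrite inE => /andP[].
have -> : #|F|.-1 = #|F :\ x| by rewrite (cardsD1 x F) xF.
rewrite mulrC -IH; last by apply: subset_trans sFP; rewrite subsetDl.
apply: eq_big => [J|J].
  rewrite in_setI setU11 xm andbT.
  case: (boolP (x \in J)) => xJ.
    have -> : (x |: J) :\ x == J = false.
      by apply/eqP => /setP/(_ x); rewrite !inE eqxx xJ.
    rewrite andbF; apply/esym/negP => /andP[/andP[/subsetP/(_ x xJ)]].
    by rewrite !inE eqxx.
  rewrite setU1K // eqxx cardsU1 xJ add1n eqSS.
  by rewrite (down_closedD1 xm) ?setU11 // setU1K // !andbT.
by case/andP => _ /eqP->; rewrite setDDl.
Qed.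

(** With [x ^+ #|F| / hooks F] in the role of [x ^+ n / n`!], this is the
    binomial formula for exponentials, of which the statement with fixed
    cardinality is the homogeneous component. *)
Lemma hooks_binomial_exp F (x : K) : F \subset P ->
  \sum_(I : {set T} | down_closed F I)
      x ^+ #|I| / (hooks I)%:R / (hooks (F :\: I))%:R
  = (x + 1) ^+ #|F| / (hooks F)%:R.
Proof.
move=> sFP; rewrite addrC exprDn.
have lt_card I : down_closed F I -> (#|I| < #|F|.+1)%N.
  by case/andP=> sIF _; rewrite ltnS subset_leq_card.
rewrite (partition_big (fun I : {set T} => inord #|I| : 'I_#|F|.+1) xpredT) //=.
rewrite mulr_suml; apply: eq_bigr => m _.
rewrite expr1n mul1r -[in RHS]mulr_natr -mulrA -hooks_binomial // mulr_sumr.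
apply: eq_big => [I|I].
  case dI: (down_closed F I) => //=.
  by rewrite -val_eqE /= inordK // lt_card.
by case/andP => dI /eqP <-; rewrite inordK ?lt_card // mulrA.
Qed.

Section Levels.
Variable N : nat.
Implicit Type g : {ffun T -> 'I_N.+1}.

(** Levels are normalised to [ord0] outside [F], so that these functions are in
    bijection with the weakly increasing functions on [F] alone. *)
Definition level_map k F g :=
  [forall x, if x \in F then (g x < k)%N else g x == ord0] &&
  [forall x in F, forall y in F, le x y ==> (g x <= g y)%N].

Definition same_level_up F g x := [set y in up F x | g y == g x].

Lemma level_mapP k F g :
  reflect [/\ {in F, forall x, (g x < k)%N},
              forall x, x \notin F -> g x = ord0 &
              {in F &, forall x y, le x y -> (g x <= g y)%N}]
          (level_map k F g).
Proof.
apply: (iffP andP) => [[/forallP gk /forall_inP gle]|[gk g0 gle]].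
  split=> [x xF|x xF|x y xF yF].
  - by have := gk x; rewrite xF.
  - by have := gk x; rewrite (negPf xF) => /eqP.
  - exact: (implyP (forall_inP (gle _ xF) _ yF)).
split; first by apply/forallP => x; case: ifPn => [/gk|/g0->].
apply/forall_inP => x xF; apply/forall_inP => y yF; apply/implyP; exact: gle.
Qed.

(** Each level set of [g] contributes its own inverse hook product.  The elements
    below the top level form a down-closed set, so that adding one level applies
    the exponential form of the binomial formula at [x = k]. *)
Lemma sum_level_maps k F : (k <= N.+1)%N -> F \subset P ->
  \sum_(g | level_map k F g)
      \prod_(x in F) #|same_level_up F g x|%:R^-1
  = k%:R ^+ #|F| / (hooks F)%:R :> K.
Proof.
elim: k F => [|k IH] F lekN sFP.
  have [->|[x0 x0F]] := set_0Vmem F.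
    rewrite (big_pred1 [ffun=> ord0]) => [|g].
      by rewrite big_set0 cards0 /hooks big_set0 divr1.
    apply/level_mapP/eqP => [[_ g0 _]|->].
      by apply/ffunP => x; rewrite ffunE g0 // inE.
    by split=> x; rewrite ?inE ?ffunE.
  rewrite big_pred0 => [|g]; last by apply/level_mapP => -[/(_ _ x0F)].
  by rewrite (cardsD1 x0) x0F expr0n mul0r.
pose low (g : {ffun T -> 'I_N.+1}) := [set x in F | (g x < k)%N].
rewrite -natr1 -hooks_binomial_exp // (partition_big low (down_closed F)) /=.
  apply: eq_bigr => I dI; have sIF : I \subset F by case/andP: dI.
  rewrite -IH 1?ltnW ?(subset_trans sIF) // mulr_suml.
  pose kk : 'I_N.+1 := Ordinal lekN.
  rewrite (reindex_onto (fun g : {ffun T -> 'I_N.+1} =>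
      [ffun x => if x \in F :\: I then kk else g x])
    (fun g => [ffun x => if x \in I then g x else ord0])); last first.
    move=> g /andP[/level_mapP[gk g0 gle] /eqP<-]; apply/ffunP => x.
    rewrite !ffunE !inE; case xF: (x \in F); last by rewrite g0 ?xF.
    rewrite !andbT /= -leqNgt; case: ltnP => //= lekg.
    by apply: val_inj; apply/eqP; rewrite eqn_leq lekg -ltnS gk.
  have inFI x : x \in I -> x \in F :\: I = false by rewrite inE => ->.
  apply: eq_big => [g|g].
    apply/andP/level_mapP.
      case=> /andP[/level_mapP[gk _ gle] /eqP eI] /eqP/ffunP eg; split=> [x xI|x xI|x y xI yI].
      - by have : x \in I by []; rewrite -{1}eI !inE ffunE inFI // => /andP[].
      - by rewrite -eg !ffunE (negPf xI).
      have := gle x y; rewrite !ffunE !inFI //; apply; exact: (subsetP sIF).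
    case=> gk g0 gle; split; last first.
      apply/eqP/ffunP => x; rewrite !ffunE; case: ifPn => [/inFI->//|/g0//].
    apply/andP; split.
      apply/level_mapP; split.
      - move=> x xF; rewrite ffunE inE xF andbT; case: ifPn => //=.
        by rewrite negbK => /gk/ltnW.
      - move=> x xF; rewrite ffunE inE (negPf xF) andbF g0 //.
        by apply: contraNN xF; apply: subsetP.
      move=> x y xF yF lexy; rewrite !ffunE !inE xF yF !andbT.
      case: (boolP (x \in I)) => xI; case: (boolP (y \in I)) => yI //=.
      + exact: gle.
      + exact/ltnW/gk.
      case/andP: dI => _ /forall_inP/(_ _ yI)/forall_inP/(_ _ xF).
      by rewrite lexy (negPf xI).
    apply/eqP/setP => x; rewrite !inE ffunE inE.
    case xI: (x \in I) => /=; first by rewrite (subsetP sIF) // gk.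
    by case: (x \in F) => //=; rewrite ltnn.
  case/andP => /andP[_ /eqP eI] _.
  rewrite (big_setID I) /= (setIidPr sIF) /hooks natr_prod -prodfV.
  have lowE x : x \in I -> (g x < k)%N.
    by move=> xI; have := xI; rewrite -{1}eI !inE ffunE inFI // => /andP[].
  congr (_ * _); apply: eq_bigr => x xFI; congr (#|pred_of_set _|%:R^-1); apply/setP => y.
    rewrite !inE !ffunE (inFI x) // !inE.
    case yI: (y \in I) => /=; first by rewrite (subsetP sIF).
    case yF: (y \in F) => //=; case: (le x y) => //=.
    by apply/negbTE; rewrite -val_eqE /= neq_ltn lowE ?orbT.
  rewrite !inE !ffunE xFI ?inE.
  case yI: (y \in I) => /=; last by case: (y \in F); rewrite //= eqxx andbT.
  rewrite (subsetP sIF) //=; case: (le x y) => //=.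
  by rewrite -val_eqE /= ltn_eqF // lowE.
move=> g /level_mapP[gk _ gle]; rewrite /down_closed; apply/andP; split.
  by apply/subsetP => x; rewrite inE => /andP[].
apply/forall_inP => x; rewrite inE => /andP[xF gx].
apply/forall_inP => y yF; apply/implyP => leyx; rewrite inE yF /=.
exact: leq_ltn_trans (gle _ _ yF xF leyx) gx.
Qed.

End Levels.
End Hooks.

(** * Schroeder trees and their words of labels *)

Section Trees.
Local Open Scope nat_scope.
Local Notation leaf := (PNode [::]).
Implicit Types (t : ptree) (ts : seq ptree) (w u : seq nat) (p q : seq nat).

(** Keeping the separator in front of the first tree makes the list of sectors
    obey a plain recursion; [sectors] drops that separator. *)
Definition forest_sectors (c : nat) ts : seq (seq nat) :=
  flatten [seq [::] :: map (cons jt.1) (sectors jt.2) | jt <- zip (iota c (size ts)) ts].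

Lemma sectorsE ts : sectors (PNode ts) = behead (forest_sectors 0 ts).
Proof.
rewrite /= /forest_sectors size_map; congr (behead (flatten _)).
elim: ts 0 => //= t ts IH c; congr (_ :: _); exact: IH.
Qed.

Lemma forest_sectors_cons c t ts : forest_sectors c (t :: ts) =
  [::] :: map (cons c) (sectors t) ++ forest_sectors c.+1 ts.
Proof. by []. Qed.

Lemma mem_forest_sectors c ts p : p \in forest_sectors c ts =
  if p is j :: q then [&& c <= j, j < c + size ts & q \in sectors (nth leaf ts (j - c))]
  else (ts != [::]).
Proof.
elim: ts c p => [|t ts IH] c p.
  by case: p => [|j q] //=; rewrite addn0 ltnNge; case: leqP.
rewrite forest_sectors_cons inE mem_cat IH; case: p => [|j q] //.
have -> : (j :: q == [::]) = false by [].
rewrite orFb addnS.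
have [ltjc|ltcj|->] := ltngtP j c.
- rewrite andFb orbF; apply/mapP => -[x _ [/eqP]]; lia.
- have -> : j :: q \in [seq c :: i | i <- sectors t] = false.
    by apply/mapP => -[x _ [/eqP]]; lia.
  by rewrite orFb addSn -[j - c]/(j.+1 - c.+1) subSn.
rewrite orbF subnn ltnS leq_addr /=.
by rewrite mem_map // => x y [].
Qed.

Lemma mem_sectors ts p : p \in sectors (PNode ts) =
  if p is j :: q then (j < size ts) && (q \in sectors (nth leaf ts j))
  else 1 < size ts.
Proof.
rewrite sectorsE; case: ts => [|t ts]; first by case: p.
rewrite forest_sectors_cons [behead _]/= mem_cat mem_forest_sectors.
case: p => [|[|j] q].
- by case: ts => [|t' ts]; rewrite ?orbT ?orbF //; apply/mapP => -[].
- by rewrite orbF /= mem_map // => x y [].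
rewrite subn1 add1n ltnS /=.
suff -> : (j.+1 :: q \in [seq 0 :: i | i <- sectors t]) = false by [].
by apply/mapP => -[].
Qed.

Lemma size_sectors t : schroeder t -> (size (sectors t)).+1 = nleaves t.
Proof.
elim/ptree_mem_ind: t => ts IH; rewrite sectorsE.
have E c : (forall t, t \in ts -> schroeder t) ->
    size (forest_sectors c ts) = sumn (map nleaves ts).
  elim: ts IH c => // t ts IHts IH c sch.
  rewrite forest_sectors_cons [size _]/= size_cat size_map [sumn _]/= -addSn.
  rewrite IH ?mem_head ?sch ?mem_head //.
  rewrite IHts // => [u uts|u uts]; first by apply: IH; rewrite inE uts orbT.
  by apply: sch; rewrite inE uts orbT.
case/andP=> _ /allP sch; rewrite size_behead E //; case: ts sch {E IH} => //= t ts _.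
by have := nleaves_gt0 t; lia.
Qed.

Fixpoint split_at (m : nat) w : seq (seq nat) :=
  if w is x :: w' then
    if x == m then [::] :: split_at m w'
    else (x :: head [::] (split_at m w')) :: behead (split_at m w')
  else [:: [::]].

(** [split_at m] and [join_at m] are mutually inverse between words and nonempty
    lists of words avoiding [m]. *)
Definition join_at (m : nat) (us : seq (seq nat)) :=
  behead (flatten [seq m :: u | u <- us]).

Lemma split_at_cat m u w : m \notin u ->
  split_at m (u ++ m :: w) = u :: split_at m w.
Proof.
elim: u => [|x u IH] /=; first by rewrite eqxx.
by rewrite inE negb_or eq_sym => /andP[/negPf-> /IH->].
Qed.

Lemma split_at_notin m u : m \notin u -> split_at m u = [:: u].
Proof.
elim: u => [|x u IH] //=.
by rewrite inE negb_or eq_sym => /andP[/negPf-> /IH->].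
Qed.

Lemma join_atK m us : us != [::] -> all (fun u => m \notin u) us ->
  split_at m (join_at m us) = us.
Proof.
elim: us => //= u us IH _ /andP[mu]; rewrite /join_at /=.
case: us IH => [|v us] IH; first by rewrite cats0 split_at_notin.
by move=> H; rewrite /= split_at_cat // -[v ++ _]/(join_at m (v :: us)) IH.
Qed.

Lemma split_atK m w : join_at m (split_at m w) = w.
Proof.
rewrite /join_at; elim: w => //= x w IH; case: eqP => [->|_] /=.
  by move: IH; case: w => //= y w; case: ifP => //= _ ->.
by move: IH; case: (split_at m w) => /= [<-|u us -> //].
Qed.

Lemma split_at_neq0 m w : split_at m w != [::].
Proof. by case: w => //= x w; case: ifP. Qed.

Lemma size_split_at m w : size (split_at m w) = (count_mem m w).+1.
Proof.
elim: w => //= x w IH; case: eqP => _ /=; rewrite ?IH //.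
by rewrite size_behead IH.
Qed.

Lemma mem_split_at m w u x : u \in split_at m w -> x \in u -> (x \in w) && (x != m).
Proof.
elim: w u => [|y w IH] u /=; first by rewrite inE => /eqP->.
case: eqP => [->|ym]; rewrite inE => /predU1P[->//|].
- by move/IH=> H /H; rewrite inE => /andP[-> ->]; rewrite orbT.
- rewrite inE => /predU1P[->|]; first by rewrite mem_head; apply/eqP.
  case E: (split_at m w) (split_at_neq0 m w) => [//|v vs] _ /= xv.
  have := IH v; rewrite E mem_head => /(_ isT xv); rewrite inE => /andP[-> ->].
  by rewrite orbT.
move=> us /(IH _ (mem_behead us)); rewrite inE => /andP[-> ->].
by rewrite orbT.
Qed.

Lemma size_mem_split_at m w u : m \in w -> u \in split_at m w -> size u < size w.
Proof.
have le v z : v \in split_at m z -> size v <= size z.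
  elim: z v => [|y z IH] v /=; first by rewrite inE => /eqP->.
  case: eqP => _; rewrite inE => /predU1P[->|]; rewrite ?size_nseq //=.
  - by move/IH/leqW.
  - by rewrite ltnS IH // -nth0 mem_nth // lt0n size_eq0 split_at_neq0.
  by move/mem_behead/IH/leqW.
elim: w u => [|y w IH] u //=; rewrite inE eq_sym; case: eqP => [_ _|_ /= mw].
  by rewrite inE => /predU1P[->//|/le]; rewrite ltnS.
rewrite inE => /predU1P[->|/mem_behead/(IH _ mw)/leqW//] /=.
by rewrite ltnS IH // -nth0 mem_nth // lt0n size_eq0 split_at_neq0.
Qed.

Definition min_letter w := foldr minn (head 0 w) w.

Lemma min_letter_le w x : x \in w -> min_letter w <= x.
Proof.
rewrite /min_letter; elim: w (head 0 w) => //= y w IH z.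
by rewrite inE geq_min => /predU1P[->|/IH->]; rewrite ?leqnn ?orbT.
Qed.

Lemma min_letter_mem w : w != [::] -> min_letter w \in w.
Proof.
case: w => // x w _; rewrite /min_letter [head _ _]/=.
(* The default letter of the fold is the head of the word, hence harmless. *)
suff H v : v != [::] -> foldr minn x v \in x :: v.
  by have := H (x :: w) isT; rewrite !inE orbA orbb.
elim: v => [|y [|z v] IH] // _; first by rewrite /= minnC /minn; case: ifP; rewrite !inE eqxx ?orbT.
rewrite [foldr _ _ _]/= -/(foldr minn x (z :: v)) {1}/minn; case: ifP => _.
  by rewrite !inE eqxx orbT.
by have := IH isT; rewrite !inE => /orP[->//|->]; rewrite !orbT.
Qed.

Lemma min_letterE w m : m \in w -> (forall x, x \in w -> m <= x) -> min_letter w = m.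
Proof.
move=> mw H; apply/eqP; rewrite eqn_leq min_letter_le // H // min_letter_mem //.
by case: w mw {H}.
Qed.

(** The first argument is fuel; any bound on the length of the word will do, see
    [buildE]. *)
Fixpoint build k w : ptree :=
  if k is k'.+1 then
    if nilp w then leaf else PNode (map (build k') (split_at (min_letter w) w))
  else leaf.
Definition cartesian_tree w := build (size w) w.

Lemma buildE k w : size w <= k -> build k w = cartesian_tree w.
Proof.
rewrite /cartesian_tree; elim: k {-2}k (leqnn k) w => [|K IH] k leK w lew.
  by have -> : k = size w by lia.
case: k lew leK => [|k] lew leK; first by case: w lew.
case: w lew => // x w lew; congr PNode; apply/eq_in_map => u.
move/(size_mem_split_at (min_letter_mem (isT : x :: w != [::]))) => /= ltu.
move: lew => /= lew.
by rewrite -[LHS]/(build k u) -[RHS]/(build (size w) u) (IH k) ?[RHS]IH //; lia.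
Qed.

Lemma cartesian_treeE w : w != [::] ->
  cartesian_tree w = PNode (map cartesian_tree (split_at (min_letter w) w)).
Proof.
case: w => // x w _; rewrite {1}/cartesian_tree /=; congr PNode; apply/eq_in_map => u.
move/(size_mem_split_at (min_letter_mem (isT : x :: w != [::]))) => ltu.
by rewrite -[LHS]/(build (size w) u) buildE.
Qed.

Definition increasing t (f : seq nat -> nat) := forall p q,
  p \in sectors t -> q \in sectors t -> prefix p q -> p != q -> f p < f q.

Lemma map_sectors f ts : map f (sectors (PNode ts)) =
  join_at (f [::]) [seq map (fun q => f (jt.1 :: q)) (sectors jt.2)
                   | jt <- zip (iota 0 (size ts)) ts].
Proof.
rewrite sectorsE /join_at -behead_map /forest_sectors map_flatten -!map_comp.
congr (behead (flatten _)); apply: eq_map => jt /=.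
by rewrite -map_comp.
Qed.

(** The root label is strictly smaller than all others, so it is the smallest
    letter and its occurrences are exactly the root sectors; cutting there leaves
    the words of the subtrees. *)
Lemma cartesian_tree_sectors t f : schroeder t -> increasing t f ->
  cartesian_tree (map f (sectors t)) = t.
Proof.
elim/ptree_mem_ind: t f => ts IH f sch incf.
case: (eqVneq ts [::]) => [->//|tsn0].
have sz : 1 < size ts by move: sch tsn0 => /andP[]; case: ts {IH incf} => [|?[]].
have mem0 : [::] \in sectors (PNode ts) by rewrite mem_sectors.
have minE : min_letter (map f (sectors (PNode ts))) = f [::].
  apply: min_letterE => [|_ /mapP[p ps ->]]; first exact: map_f.
  by case: (eqVneq [::] p) => [<-//|np]; apply/ltnW/incf; rewrite ?prefix0s.
have wn0 : map f (sectors (PNode ts)) != [::].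
  by rewrite -size_eq0 size_map size_eq0; case: (sectors _) mem0.
rewrite cartesian_treeE // minE map_sectors join_atK.
- congr PNode; rewrite -map_comp.
  apply: (@eq_from_nth _ leaf).
    by rewrite size_map size_zip size_iota minnn.
  move=> j; rewrite size_map size_zip size_iota minnn => ltj.
  have sch' : forall t, t \in ts -> schroeder t by case/andP: sch => _ /allP.
  rewrite (nth_map (0, leaf)) ?size_zip ?size_iota ?minnn // nth_zip ?size_iota //=.
  rewrite nth_iota //= add0n; apply: IH; rewrite ?sch' ?mem_nth //.
  move=> p q ps qs pq npq; apply: incf; rewrite ?mem_sectors ?ltj //.
    by rewrite /= eqxx.
  by rewrite eqseq_cons eqxx.
- by rewrite -size_eq0 size_map size_zip size_iota minnn size_eq0.
apply/allP => _ /mapP[[j t] jt ->] /=.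
case/(nthP (0, leaf)): jt => i; rewrite size_zip size_iota minnn => lti.
rewrite nth_zip ?size_iota // nth_iota // add0n => -[ij it].
apply/mapP => -[q qs] /eqP; rewrite ltn_eqF //; apply: incf; rewrite ?prefix0s //.
by rewrite mem_sectors -ij lti it.
Qed.

(** The label that the Cartesian tree of [w] carries at the address [p]. *)
Fixpoint letter_at w p : nat :=
  if p is j :: p' then letter_at (nth [::] (split_at (min_letter w) w) j) p'
  else min_letter w.

(** Converse of [cartesian_tree_sectors]: every word is the word of labels of an
    increasing Schroeder tree.  The root has at least two children because the
    smallest letter occurs at least once. *)
Lemma cartesian_treeP w : [/\ schroeder (cartesian_tree w),
  map (letter_at w) (sectors (cartesian_tree w)) = w &
  increasing (cartesian_tree w) (letter_at w)].
Proof.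
elim: {w}(size w) {-2}w (leqnn (size w)) => [|K IH] w lew.
  by case: w lew.
case: (eqVneq w [::]) => [->//|wn0].
set m := min_letter w; set us := split_at m w.
have mw := min_letter_mem wn0; rewrite -/m in mw.
have IHu u : u \in us -> [/\ schroeder (cartesian_tree u),
  map (letter_at u) (sectors (cartesian_tree u)) = u &
  increasing (cartesian_tree u) (letter_at u)].
  by move/(size_mem_split_at mw) => ltu; apply: IH; lia.
have szus : 1 < size us by rewrite /us size_split_at ltnS -has_count has_pred1.
rewrite cartesian_treeE // -/m -/us; split.
- rewrite /= size_map gtn_eqF // all_map; apply/allP => u /IHu[]//.
- rewrite map_sectors -[RHS](split_atK m) -/us; congr join_at.
  apply: (@eq_from_nth _ [::]); rewrite size_map size_zip size_iota minnn size_map //.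
  move=> j ltj; rewrite (nth_map (0, leaf)) ?size_zip ?size_iota ?size_map ?minnn //.
  rewrite nth_zip ?size_iota ?size_map // nth_iota // add0n /= (nth_map [::]) //.
  by have [_ E _] := IHu _ (mem_nth [::] ltj).
move=> [|j p] [|i q] //; rewrite !mem_sectors !size_map.
  move=> _ /andP[lti]; rewrite (nth_map [::]) // => qs _ _ /=.
  rewrite -/m -/us; have usi := mem_nth [::] lti; have [_ E _] := IHu _ usi.
  have : letter_at (nth [::] us i) q \in nth [::] us i by rewrite -[X in _ \in X]E map_f.
  case/(mem_split_at usi)/andP => /min_letter_le; rewrite -/m => le ne.
  by rewrite ltn_neqAle eq_sym ne.
move=> /andP[ltj ps] /andP[lti qs]; rewrite prefix_cons => /andP[/eqP ji pq].
rewrite eqseq_cons ji eqxx /= -/m -/us => npq.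
have [_ _ inc] := IHu _ (mem_nth [::] lti); apply: inc => //.
  by move: ps; rewrite ji (nth_map [::]).
by move: qs; rewrite (nth_map [::]).
Qed.

(** Together with [contiguous], this is all that the comparison of the partition
    of a tree with a level partition uses about the planar order of sectors. *)
Definition has_common_ancestor (s : seq (seq nat)) := forall i j, i <= j -> j < size s ->
  exists m, [/\ i <= m, m <= j & forall l, i <= l -> l <= j ->
     prefix (nth [::] s m) (nth [::] s l)].

Definition contiguous p (s : seq (seq nat)) := forall i l j, i <= l -> l <= j ->
  j < size s -> prefix p (nth [::] s i) -> prefix p (nth [::] s j) ->
  prefix p (nth [::] s l).

Lemma has_common_ancestor_map c s : has_common_ancestor s -> has_common_ancestor (map (cons c) s).
Proof.
move=> H i j leij; rewrite size_map => ltj; have [m [im mj Hm]] := H i j leij ltj.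
exists m; split=> // l il lj.
by rewrite !(nth_map [::]) ?prefix_cons ?eqxx ?Hm //; lia.
Qed.

Lemma has_common_ancestor_cat s1 s2 : has_common_ancestor s1 -> has_common_ancestor s2 ->
  has_common_ancestor (s1 ++ [::] :: s2).
Proof.
move=> H1 H2 i j leij; rewrite size_cat /= => ltj.
case: (ltnP j (size s1)) => [ltj1|lej1].
  have [m [im mj Hm]] := H1 i j leij ltj1; exists m; split=> // l il lj.
  by rewrite !nth_cat !ifT ?Hm //; lia.
case: (leqP i (size s1)) => [lei1|ltj1]; last first.
  have [m [im mj Hm]] := H2 (i - (size s1).+1) (j - (size s1).+1) ltac:(lia) ltac:(lia).
  exists (m + (size s1).+1); split=> [||l il lj]; try lia.
  have := Hm (l - (size s1).+1) ltac:(lia) ltac:(lia).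
  rewrite !nth_cat !ifF; try lia.
  have -> : m + (size s1).+1 - size s1 = m.+1 by lia.
  by have -> : l - size s1 = (l - (size s1).+1).+1 by lia.
by exists (size s1); split=> // l il lj; rewrite nth_cat ltnn subnn prefix0s.
Qed.

Lemma contiguous_map c p s : contiguous p s -> contiguous (c :: p) (map (cons c) s).
Proof.
move=> H i l j il lj; rewrite size_map => ltj.
by rewrite !(nth_map [::]) ?prefix_cons ?eqxx //=; [exact: H | lia..].
Qed.

Lemma contiguous_catl p s1 s2 : contiguous p s1 -> all (fun q => ~~ prefix p q) s2 ->
  contiguous p (s1 ++ s2).
Proof.
move=> H1 /allP H2 i l j il lj; rewrite size_cat !nth_cat => ltj.
case: (ltnP j (size s1)) => [ltj1|lej1 _ pj].
  by rewrite !ifT; [exact: H1 | lia..].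
by have := H2 _ (mem_nth [::] (_ : j - size s1 < size s2)); rewrite pj => /(_ ltac:(lia)).
Qed.

Lemma contiguous_catr p s1 s2 : all (fun q => ~~ prefix p q) s1 -> contiguous p s2 ->
  contiguous p (s1 ++ s2).
Proof.
move=> /allP H1 H2 i l j il lj; rewrite size_cat !nth_cat => ltj.
case: (ltnP i (size s1)) => [lti1 pi|lei1].
  by have := H1 _ (mem_nth [::] lti1); rewrite pi.
by rewrite !ifF; [apply: H2; lia | lia..].
Qed.

Lemma has_common_ancestor_sectors t : has_common_ancestor (sectors t).
Proof.
elim/ptree_mem_ind: t => ts IH; rewrite sectorsE.
have E c ts' : {subset ts' <= ts} -> has_common_ancestor (behead (forest_sectors c ts')).
  elim: ts' c => [|t ts' IHts] c sub; first by move=> i j.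
  have ht : has_common_ancestor (map (cons c) (sectors t)).
    by apply/has_common_ancestor_map/IH/sub/mem_head.
  rewrite forest_sectors_cons /=; case: ts' IHts sub => [|t' ts'] IHts sub.
    by rewrite cats0.
  apply: has_common_ancestor_cat => //; apply: (IHts c.+1) => u uts.
  by apply: sub; rewrite inE uts orbT.
exact: E.
Qed.

Lemma contiguous_sectors p t : contiguous p (sectors t).
Proof.
elim/ptree_mem_ind: t p => ts IH p; rewrite sectorsE.
case: p => [|d p]; first by move=> i l j *; rewrite prefix0s.
have E c ts' : {subset ts' <= ts} -> contiguous (d :: p) (forest_sectors c ts').
  elim: ts' c => [|t ts' IHts] c sub; first by move=> i l j.
  rewrite forest_sectors_cons -(cat1s [::]); apply: contiguous_catr => //.
  have cm : (c = d) -> contiguous (d :: p) (map (cons c) (sectors t)).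
    by move=> ->; apply/contiguous_map/IH/sub/mem_head.
  have sub' : {subset ts' <= ts} by move=> u uts; apply: sub; rewrite inE uts orbT.
  case: (eqVneq c d) => [cd|ncd].
    apply: contiguous_catl; first exact: cm.
    apply/allP => -[|e q] //; rewrite mem_forest_sectors prefix_cons.
    by case/andP=> lt _; rewrite negb_and; apply/orP; left; lia.
  apply: contiguous_catr; last exact: IHts.
  apply/allP => _ /mapP[q _ ->]; rewrite prefix_cons eq_sym.
  by rewrite (negPf ncd).
have := E 0 ts (fun _ => id); case: (forest_sectors 0 ts) => // x s H i l j il lj ltj.
by apply: (H i.+1 l.+1 j.+1).
Qed.

(** The skeleton drops the leaves, which shifts the rank of each remaining child;
    this translates the address of an internal vertex accordingly. *)
Fixpoint skeleton_address t p : seq nat :=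
  if p is j :: p' then count (predC is_leaf) (take j (children t)) ::
    skeleton_address (nth leaf (children t) j) p'
  else [::].

Lemma skeletonE ts :
  skeleton (PNode ts) = PNode (map skeleton (filter (predC is_leaf) ts)).
Proof. by rewrite /=; congr PNode; elim: ts => //= t ts ->; case: is_leaf. Qed.

Lemma mem_vertices ts p : p \in vertices (PNode ts) =
  if p is j :: q then (j < size ts) && (q \in vertices (nth leaf ts j)) else true.
Proof.
rewrite /= inE; case: p => [|j q] //=.
rewrite size_map.
suff E c : (j :: q \in flatten [seq [seq jv.1 :: i | i <- jv.2]
     | jv <- zip (iota c (size ts)) [seq vertices i | i <- ts]]) =
   [&& c <= j, j < c + size ts & q \in vertices (nth leaf ts (j - c))].
  by rewrite E /= subn0.
elim: ts c => [|t ts IH] c /=; first by rewrite addn0 ltnNge; case: leqP.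
rewrite mem_cat IH addnS.
have [ltjc|ltcj|->] := ltngtP j c.
- rewrite andFb orbF; apply/mapP => -[x _ [/eqP]]; lia.
- have -> : j :: q \in [seq c :: i | i <- vertices t] = false.
    by apply/mapP => -[x _ [/eqP]]; lia.
  by rewrite orFb addSn -[j - c]/(j.+1 - c.+1) subSn.
rewrite orbF subnn ltnS leq_addr /=.
by rewrite mem_map // => x y [].
Qed.

Lemma nth_filter_count (a : pred ptree) ts j : j < size ts -> a (nth leaf ts j) ->
  (count a (take j ts) < size (filter a ts)) /\
  nth leaf (filter a ts) (count a (take j ts)) = nth leaf ts j.
Proof.
elim: ts j => [|t ts IH] [|j] //=; first by move=> _ ->.
by rewrite ltnS => ltj aj; have [] := IH j ltj aj; case: (a t); rewrite /= ?add0n ?add1n.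
Qed.

Lemma count_take_surj (a : pred ptree) ts c : c < size (filter a ts) ->
  exists j, [/\ j < size ts, a (nth leaf ts j) & count a (take j ts) = c].
Proof.
elim: ts c => [|t ts IH] //= c; case: ifP => at_.
  case: c => [_|c]; first by exists 0; rewrite /= at_.
  by rewrite /= ltnS => /IH[j [ltj aj <-]]; exists j.+1; rewrite /= at_.
by move=> /IH[j [ltj aj <-]]; exists j.+1; rewrite /= at_.
Qed.

Lemma count_take_inj (a : pred ptree) ts i j : i < size ts -> j < size ts ->
  a (nth leaf ts i) -> a (nth leaf ts j) ->
  count a (take i ts) = count a (take j ts) -> i = j.
Proof.
elim: ts i j => [|t ts IH] [|i] [|j] //=.
- by move=> _ _ ->.
- by move=> _ _ _ ->.
by rewrite !ltnS => lti ltj ai aj /addnI E; congr _.+1; apply: IH.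
Qed.

Lemma sectors_not_leaf t p : p \in sectors t -> predC is_leaf t.
Proof. by case: t => -[|u us]. Qed.

Lemma skeleton_address_vertices t p :
  p \in sectors t -> skeleton_address t p \in vertices (skeleton t).
Proof.
elim: p t => [|j p IH] [ts]; first by rewrite skeletonE mem_vertices.
rewrite mem_sectors => /andP[ltj ps]; rewrite skeletonE mem_vertices /= size_map.
have [lt E] := nth_filter_count ltj (sectors_not_leaf ps).
by rewrite lt (nth_map leaf) // E IH.
Qed.

(** An internal vertex with a single child would carry no sector, which is why the
    tree has to be a Schroeder tree. *)
Lemma skeleton_address_surj t q : schroeder t -> ~~ is_leaf t ->
  q \in vertices (skeleton t) ->
  exists2 p, p \in sectors t & skeleton_address t p = q.
Proof.
elim: q t => [|c q IH] [ts] sch nl.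
  move=> H; exists [::] => //; rewrite mem_sectors.
  by case: ts sch nl {H} => [|? [|? ?]].
rewrite skeletonE mem_vertices size_map => /andP[ltc].
have [j [ltj aj E]] := count_take_surj ltc.
rewrite (nth_map leaf) // -E (nth_filter_count ltj aj).2 => qs.
have [|p ps <-] := IH _ _ aj qs.
  by case/andP: sch => _ /allP; apply; rewrite mem_nth.
by exists (j :: p); rewrite //= mem_sectors ltj.
Qed.

Lemma prefix_skeleton_address t p q : p \in sectors t -> q \in sectors t ->
  prefix (skeleton_address t p) (skeleton_address t q) = prefix p q.
Proof.
elim: p t q => [|j p IH] [ts] [|i q] //.
rewrite !mem_sectors [skeleton_address _ (j :: p)]/= [skeleton_address _ (i :: q)]/=.
move=> /andP[ltj ps] /andP[lti qs]; rewrite !prefix_cons.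
have [ij|nij] := eqVneq i j; first by rewrite -ij eqxx IH // ?ij // -ij.
case: eqP => // /count_take_inj E.
by case/eqP: nij; apply/esym/E => //; apply: sectors_not_leaf; eassumption.
Qed.

Lemma skeleton_address_inj t :
  {in sectors t &, injective (skeleton_address t)}.
Proof.
move=> p q ps qs E.
have pq : prefix p q by rewrite -(prefix_skeleton_address ps qs) E prefix_refl.
have qp : prefix q p by rewrite -(prefix_skeleton_address qs ps) E prefix_refl.
case/prefixP: pq qp => r ->; case/prefixP => r' /(congr1 size).
by rewrite !size_cat; case: r => [|? ?] /=; rewrite ?cats0 //; lia.
Qed.

End Trees.

(** * Level functions and Schroeder trees *)

Section LevelPartition.
Local Open Scope nat_scope.
Variable n : nat.
Implicit Types (l : 'I_n -> nat) (t : schroeder_tree n).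

Definition level_rel l : rel 'I_n := fun i j =>
  (l i == l j) && [forall m : 'I_n, (minn i j <= m <= maxn i j) ==> (l i <= l m)].
Definition level_partition l := equivalence_partition (level_rel l) setT.
Definition level_word l := [seq l i | i <- enum 'I_n].

Lemma size_level_word l : size (level_word l) = n.
Proof. by rewrite size_map size_enum_ord. Qed.

Lemma nth_level_word l (i : 'I_n) : nth 0 (level_word l) i = l i.
Proof. by rewrite (nth_map i) ?size_enum_ord // nth_ord_enum. Qed.

Lemma size_sectors_ord t : size (sectors t) = n.
Proof.
case: t => t /= /andP[sch /eqP nl]; apply/eqP.
by rewrite -eqSS (size_sectors sch) nl.
Qed.

Lemma mem_sectors_ord t (i : 'I_n) : nth [::] (sectors t) i \in sectors t.
Proof. by rewrite mem_nth // size_sectors_ord. Qed.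

(** Equal vertices give equal levels, with larger levels in between because the
    sectors in between lie below that vertex.  Conversely, if two points of the
    same level have no smaller level between them, the sector at the common
    ancestor of the interval cannot be strictly above either of them. *)
Lemma level_treeP l t (f : seq nat -> nat) : increasing t f ->
  (forall i : 'I_n, l i = f (nth [::] (sectors t) i)) ->
  tree_partition t = level_partition l.
Proof.
move=> incf lE; rewrite /tree_partition /level_partition /preim_partition.
rewrite /equivalence_partition; apply: eq_imset => i; apply/setP => j.
rewrite !inE /=; set s := sectors t in lE *.
have le_f p q : p \in s -> q \in s -> prefix p q -> f p <= f q.
  by move=> ps qs pq; case: (eqVneq p q) => [->//|/incf H]; apply/ltnW/H.
wlog leij : i j / i <= j => [IH|].
  case: (leqP i j) => [/IH//|/ltnW/IH]; rewrite eq_sym => ->.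
  rewrite /level_rel minnC maxnC eq_sym; case: eqP => //= ->.
  by [].
rewrite /level_rel (minn_idPl leij) (maxn_idPr leij); apply/eqP/andP.
  move=> E; split; first by rewrite !lE E.
  apply/forall_inP => m /andP[im mj]; rewrite !lE.
  apply: le_f; rewrite ?mem_sectors_ord //.
  apply: (contiguous_sectors im mj); rewrite ?size_sectors_ord ?prefix_refl //.
  by rewrite -/s -E prefix_refl.
case=> /eqP lij /forall_inP H.
have ltj : j < size s by rewrite size_sectors_ord.
have [m [im mj Hm]] := has_common_ancestor_sectors leij ltj.
have ltm : m < n by apply: leq_ltn_trans mj _.
have same (k : 'I_n) : i <= k -> k <= j -> l k = l i -> nth [::] s m = nth [::] s k.
  move=> ik kj lki; apply/eqP; case: eqVneq => // ne.
  have := incf _ _ (mem_sectors_ord t (Ordinal ltm)) (mem_sectors_ord t k) (Hm k ik kj) ne.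
  have := H (Ordinal ltm); rewrite /= im mj => /(_ isT).
  by rewrite -(lE k) lki (lE (Ordinal ltm)) /=; rewrite ltnNge => ->.
by rewrite -(same i) // -(same j).
Qed.

Lemma tree_of_levels l :
  exists2 t : schroeder_tree n, stree t = cartesian_tree (level_word l) &
    tree_partition t = level_partition l.
Proof.
have [sch E inc] := cartesian_treeP (level_word l).
have P : schroeder (cartesian_tree (level_word l)) &&
         (nleaves (cartesian_tree (level_word l)) == n.+1).
  rewrite sch -(size_sectors sch) eqSS -(size_map (letter_at (level_word l))) E.
  by rewrite size_level_word /=.
exists (SchroederTree P) => //; apply: (@level_treeP _ (SchroederTree P) _ inc) => i /=.
rewrite -nth_level_word -{1}E (nth_map [::]) // -(size_map (letter_at (level_word l))) E.
by rewrite size_level_word.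
Qed.

Definition surjective_levels k (l : {ffun 'I_n -> 'I_k}) := [forall c, exists i, l i == c].
Definition levels_nat k (l : {ffun 'I_n -> 'I_k}) (i : 'I_n) : nat := l i.

(** A strict surjection on the skeleton is transported to the sectors; injectivity
    of the transport and the description of its image come from the fact that
    each vertex of the skeleton carries a sector. *)
Lemma murua_count_levels k t : 0 < n ->
  murua_count k (skeleton t) =
  #|[set l : {ffun 'I_n -> 'I_k} | surjective_levels l &&
       (cartesian_tree (level_word (levels_nat l)) == t)]|.
Proof.
move=> n_gt0; have sch : schroeder t by case: t => t /= /andP[].
have nlf : ~~ is_leaf t.
  have := size_sectors_ord t; case: (stree t) => -[|//] /=; lia.
set s := sectors t; have sz : size s = n := size_sectors_ord t.
have inV (i : 'I_n) : skeleton_address t (nth [::] s i) \in vertices (skeleton t).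
  by rewrite skeleton_address_vertices // mem_sectors_ord.
pose va i : vertex (skeleton t) := SeqSub (inV i).
have vaK (v : vertex (skeleton t)) : exists i, va i = v.
  have [p ps pv] := skeleton_address_surj sch nlf (valP v).
  have lti : index p s < n by rewrite -sz index_mem.
  by exists (Ordinal lti); apply: val_inj; rewrite /= nth_index.
pose Phi (f : {ffun vertex (skeleton t) -> 'I_k}) : {ffun 'I_n -> 'I_k} :=
  [ffun i => f (va i)].
have Phi_inj : injective Phi.
  move=> f g /ffunP E; apply/ffunP => v; have [i <-] := vaK v.
  by have := E i; rewrite !ffunE.
rewrite /murua_count -(card_imset _ Phi_inj); congr #|pred_of_set _|.
apply/setP => l; rewrite inE; apply/imsetP/andP.
  case=> f; rewrite inE => /andP[/forallP fsurj /forallP finc] ->; split.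
    apply/forallP => c; have /existsP[v fv] := fsurj c; have [i iv] := vaK v.
    by apply/existsP; exists i; rewrite ffunE iv.
  (* [f] lives on the vertices of the skeleton; [g] extends it to all addresses. *)
  pose g p : nat := if insub (skeleton_address t p) is Some v then f v else 0.
  have gE (i : 'I_n) : g (nth [::] s i) = f (va i).
    by rewrite /g insubT ?inV // => H; congr (nat_of_ord (f _)); apply: val_inj.
  have -> : level_word (levels_nat (Phi f)) = map g s.
    apply: (@eq_from_nth _ 0); rewrite size_level_word ?size_map // => i lti.
    rewrite (nth_level_word _ (Ordinal lti)) (nth_map [::]) ?sz //.
    by rewrite (gE (Ordinal lti)) /levels_nat ffunE.
  apply/eqP/cartesian_tree_sectors => // p q ps qs pq npq.
  have [ltp ltq] : index p s < n /\ index q s < n by rewrite -sz !index_mem.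
  rewrite -(nth_index [::] ps) -(nth_index [::] qs) (gE (Ordinal ltp)) (gE (Ordinal ltq)).
  have /forallP/(_ (va (Ordinal ltq)))/implyP := finc (va (Ordinal ltp)); apply.
  rewrite /vertex_lt -val_eqE /= !nth_index // prefix_skeleton_address // pq andbT.
  by apply: contraNneq npq => /skeleton_address_inj->.
case=> /forallP lsurj /eqP tE.
have [_ wE inc] := cartesian_treeP (level_word (levels_nat l)).
set f := letter_at _ in wE inc; rewrite tE -/s in wE inc.
have lE (i : 'I_n) : l i = f (nth [::] s i) :> nat.
  by rewrite -[LHS](nth_level_word (levels_nat l)) -wE (nth_map [::]) ?sz.
have in_n (v : vertex (skeleton t)) : index (val v) (map (skeleton_address t) s) < n.
  have [i <-] := vaK v.
  have := map_f (skeleton_address t) (mem_sectors_ord t i).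
  by rewrite -index_mem size_map -/s sz.
pose vb v := Ordinal (in_n v).
have vbK (i : 'I_n) : nth [::] s (vb (va i)) = nth [::] s i.
  apply: (@skeleton_address_inj t); rewrite ?mem_sectors_ord //.
  rewrite -(nth_map [::] [::]) ?sz // nth_index //.
  by apply: map_f; rewrite mem_sectors_ord.
have lvb i : l (vb (va i)) = l i by apply: val_inj; rewrite /= !lE vbK.
exists [ffun v => l (vb v)]; last by apply/ffunP => i; rewrite !ffunE lvb.
rewrite inE; apply/andP; split.
  apply/forallP => c; have /existsP[i lic] := lsurj c.
  by apply/existsP; exists (va i); rewrite ffunE lvb.
apply/forallP => v; apply/forallP => w; have [i <-] := vaK v; have [j <-] := vaK w.
rewrite !ffunE !lvb !lE; apply/implyP => /andP[ne /=].
rewrite prefix_skeleton_address ?mem_sectors_ord // => pij.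
apply: inc; rewrite ?mem_sectors_ord //.
by apply: contraNneq ne => E; rewrite -val_eqE /= E.
Qed.

End LevelPartition.

Lemma sum_trees_levels (K : pzRingType) n k (G : {set {set 'I_n}} -> K) : (0 < n)%N ->
  \sum_(t : schroeder_tree n) (murua_count k (skeleton t))%:R * G (tree_partition t)
  = \sum_(l : {ffun 'I_n -> 'I_k} | surjective_levels l)
      G (level_partition (levels_nat l)).
Proof.
move=> n_gt0.
pose tr (l : {ffun 'I_n -> 'I_k}) : option (schroeder_tree n) :=
  insub (cartesian_tree (level_word (levels_nat l))).
transitivity (\sum_(t : schroeder_tree n)
   \sum_(l : {ffun 'I_n -> 'I_k} | surjective_levels l &&
       (cartesian_tree (level_word (levels_nat l)) == t))
     G (level_partition (levels_nat l))).
  apply: eq_bigr => t _; rewrite murua_count_levels // -sum1_card natr_sum mulr_suml.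
  apply: eq_big => l; first by rewrite inE.
  rewrite inE mul1r => /andP[_ /eqP E]; congr G.
  have [t' t'E <-] := tree_of_levels (levels_nat l).
  by congr tree_partition; apply: val_inj; rewrite /= t'E.
rewrite (exchange_big_dep (@surjective_levels n k)) /=; last by move=> ? ? _ /andP[].
apply: eq_bigr => l sl; rewrite sl /=.
have [t tE _] := tree_of_levels (levels_nat l).
by rewrite (big_pred1 t) // => u; rewrite -tE eq_sym.
Qed.

(** * Tree factorials of nestings are hook products *)

Section Nesting.
Local Open Scope nat_scope.
Variable n : nat.
Implicit Types (U V W D : {set 'I_n}) (P : {set {set 'I_n}}).

(** Unlike [nest_le], this form mentions no extremal elements, so it is
    transitive on all sets and preserved by increasing maps. *)
Definition nests V W :=
  [forall w in W, [exists x in V, x <= w] && [exists y in V, w <= y]].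
Definition NC_on D := [set P | partition P D && noncrossing P].

Lemma nestsP V W : reflect (forall w, w \in W ->
  (exists2 x, x \in V & x <= w) /\ (exists2 y, y \in V & w <= y)) (nests V W).
Proof.
apply: (iffP forall_inP) => H w /H.
  by case/andP=> /exists_inP[x] ? ? /exists_inP[y] ? ?; split; [exists x | exists y].
by case=> ? ?; apply/andP; split; apply/exists_inP.
Qed.

Lemma nests_refl : reflexive nests.
Proof. by move=> V; apply/nestsP => w wV; split; exists w. Qed.

Lemma nests_trans V U W : nests U V -> nests V W -> nests U W.
Proof.
move=> /nestsP UV /nestsP VW; apply/nestsP => w.
case/VW=> [[x /UV[[x' x'U le1] _] le2] [y /UV[_ [y' y'U le3]] le4]].
by split; [exists x' | exists y'] => //; apply: leq_trans; eassumption.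
Qed.

Lemma noncrossingP P : reflect (forall V W (a b c d : 'I_n), V \in P -> W \in P ->
  a \in V -> b \in W -> c \in V -> d \in W -> a < b -> b < c -> c < d -> V = W)
  (noncrossing P).
Proof.
apply: (iffP forall_inP) => [H V W a b c d VP WP aV bW cV dW ab bc cd|H V VP].
  have /forall_inP/(_ _ WP)/forall_inP/(_ _ aV)/forall_inP/(_ _ bW) := H _ VP.
  move=> /forall_inP/(_ _ cV)/forall_inP/(_ _ dW); rewrite ab bc cd.
  by move/eqP.
do 5?[apply/forall_inP => ? ?]; apply/implyP => /andP[/andP[ab bc] cd].
by apply/eqP; apply: (H _ _ _ _ _ _ VP) ab bc cd.
Qed.

Section OnePartition.
Variables (D : {set 'I_n}) (P : {set {set 'I_n}}).
Hypothesis P_NC : P \in NC_on D.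

Let trivP : trivIset P.
Proof. by move: P_NC; rewrite inE => /andP[/and3P[]]. Qed.
Let nonempty V : V \in P -> exists i, i \in V.
Proof.
move: P_NC; rewrite inE => /andP[/and3P[_ _ P0] _] VP; apply/set0Pn.
by apply: contraNneq P0 => <-.
Qed.
Let crossP := noncrossingP P.

Lemma eq_block V W i : V \in P -> W \in P -> i \in V -> i \in W -> V = W.
Proof. by move=> VP WP iV iW; rewrite -(def_pblock trivP VP iV) (def_pblock trivP WP iW). Qed.

Lemma nests_anti : {in P &, antisymmetric nests}.
Proof.
move=> V W VP WP /andP[/nestsP VW /nestsP WV]; have [i0 i0V] := nonempty VP.
case: (@arg_minnP _ i0 (mem V) (fun i => i : nat) i0V) => i iV mini.
have [[x xW lexi] _] := WV i iV; have [[y yV leyx] _] := VW x xW.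
have leiy := mini y yV.
have ix : i = x by apply/val_inj/eqP; rewrite eqn_leq lexi (leq_trans leiy leyx).
by apply: (eq_block VP WP iV); rewrite ix.
Qed.

(** If neither hull contains the other block, one block has a point outside the
    hull of the other on the left, the other has one on the right, and together
    with the points around a common element [w] they form a crossing. *)
Lemma nests_forest U V W : U \in P -> V \in P -> W \in P ->
  nests U W -> nests V W -> nests U V || nests V U.
Proof.
move=> UP VP WP /nestsP UW /nestsP VW; have [w wW] := nonempty WP.
have [[u1 u1U le1] [u2 u2U le2]] := UW w wW.
have [[v1 v1V le3] [v2 v2V le4]] := VW w wW.
case: (eqVneq U V) => [->|/eqP UV]; first by rewrite nests_refl.
have ne u v : u \in U -> v \in V -> u != v :> nat.
  by move=> uU vV; apply/eqP => /val_inj uv; apply: UV; apply: (eq_block UP VP uU); rewrite uv.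
have nc : noncrossing P by move: P_NC; rewrite inE => /andP[].
move/crossP: nc => nc.
have side (X Y : {set 'I_n}) : ~~ nests X Y -> exists2 y, y \in Y &
    (forall x, x \in X -> y < x) \/ (forall x, x \in X -> x < y).
  rewrite negb_forall_in => /exists_inP[y yY]; rewrite negb_and => H.
  exists y => //; case/orP: H; rewrite negb_exists_in => /forall_inP H; [left|right] => x xX.
    by rewrite ltnNge H.
  by rewrite ltnNge H.
apply/norP => -[/side[v vV Hv] /side[u uU Hu]].
case: Hv Hu => Hv [] Hu.
- by have := ltn_trans (Hv u uU) (Hu v vV); rewrite ltnn.
- have := ne u1 v2 u1U v2V => ne12; apply: UV; apply/esym.
  apply: (nc V U v u1 v2 u) => //; [exact: Hv | | exact: Hu].
  by rewrite ltn_neqAle ne12 (leq_trans le1).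
- have := ne u2 v1 u2U v1V; rewrite eq_sym => ne12; apply: UV.
  apply: (nc U V u v1 u2 v) => //; [exact: Hu | | exact: Hv].
  by rewrite ltn_neqAle ne12 (leq_trans le3).
- by have := ltn_trans (Hv u uU) (Hu v vV); rewrite ltnn.
Qed.

End OnePartition.

Section HookFormula.
Variable P : {set {set 'I_n}}.
Hypothesis P_NC : P \in NC n.

Let partP : partition P setT.
Proof. by move: P_NC; rewrite inE => /andP[]. Qed.

Lemma block_max_in V : V \in P -> exists2 i, i \in V & block_max V = i.
Proof.
move=> VP; have [i iV _] := block_min_in partP VP.
have [|j jV E] := @eq_bigmax_cond _ (mem V) (fun i => i : nat); last by exists j.
by apply/card_gt0P; exists i.
Qed.

Lemma nest_le_nests V W : V \in P -> nest_le V W = nests V W.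
Proof.
move=> VP; have [i iV mini] := block_min_in partP VP; have [j jV maxj] := block_max_in VP.
apply/forall_inP/nestsP => H w wW.
  by have /andP[le1 le2] := H w wW; split; [exists i; rewrite -?mini|exists j; rewrite -?maxj].
have [[x xV le1] [y yV le2]] := H w wW.
by rewrite (leq_trans (block_minP xV) le1) (leq_trans le2 (block_maxP yV)).
Qed.

Let up_P := up nests P.
Let anti := nests_anti P_NC.
Let forest := nests_forest P_NC.
Let trans V U W (_ : V \in P) (_ : U \in P) (_ : W \in P) : nests V U -> nests U W -> nests V W
  := @nests_trans U V W.

Lemma nest_rootsE : nest_roots P = minimals nests P.
Proof.
apply/setP => V; rewrite !inE; case VP: (V \in P) => //=.
rewrite negb_exists; apply: eq_forallb => U; rewrite negb_and -implybE.
case UP: (U \in P) => //=; rewrite /nest_lt nest_le_nests // negb_and negbK orbC.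
by rewrite -implybE.
Qed.

(** The children of [V] are the roots of the forest of blocks strictly nested in
    [V], so that trees and forests are handled by the same [big_up_minimals]. *)
Lemma nest_childrenE V : V \in P -> nest_children P V = minimals nests (up_P V :\ V).
Proof.
move=> VP; apply/setP => W; rewrite !inE; case WP: (W \in P); rewrite ?andbF //=.
rewrite {1}/nest_lt nest_le_nests // (eq_sym V W); congr (_ && _).
rewrite negb_exists; apply: eq_forallb => U; rewrite !inE.
case UP: (U \in P); rewrite ?andbF //= /nest_lt !nest_le_nests // (eq_sym V U).
by do 2!case: (_ == _); case: (nests V U); case: (nests U W).
Qed.

Lemma up_children V U : V \in P -> U \in up_P V :\ V -> up nests (up_P V :\ V) U = up_P U.
Proof.
move=> VP; rewrite !inE => /and3P[UV UP VU]; apply/setP => W; rewrite !inE.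
case UW: (nests U W); rewrite ?andbF ?andbT //.
case WP: (W \in P); rewrite ?andbF //= (trans VP UP WP) // andbT.
apply: contraNneq UV => WV; rewrite WV in UW; apply/eqP/anti => //.
by rewrite UW VU.
Qed.

(** The vertices of the subtree at [V] are the blocks nested in [V]; unfolding the
    recursion of the tree factorial, each contributes its hook length once. *)
Lemma nest_tree_hooks V : V \in P ->
  nvertices (nest_tree P V) = #|up_P V| /\
  tree_factorial (nest_tree P V) = \prod_(W in up_P V) #|up_P W|.
Proof.
elim: {V}_.+1 {-2}V (ltnSn #|up_P V|) => // k IH V ltk VP.
have Vup : V \in up_P V by rewrite inE VP nests_refl.
have sub : up_P V :\ V \subset P by apply/subsetP => W; rewrite !inE => /and3P[].
have IHU U : U \in nest_children P V -> nvertices (nest_tree P U) = #|up_P U| /\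
  tree_factorial (nest_tree P U) = \prod_(W in up_P U) #|up_P W|.
  rewrite nest_childrenE // inE => /andP[Uup _]; apply: IH; last exact: (subsetP sub).
  have ltUV : #|up_P U| < #|up_P V|.
    rewrite [ltnRHS](cardsD1 V) Vup add1n ltnS -(up_children VP Uup).
    by apply/subset_leq_card/subsetP => W; rewrite inE => /andP[].
  exact: leq_trans ltUV ltk.
have nvE : nvertices (nest_tree P V) = #|up_P V|.
  rewrite nest_treeE //= -map_comp sumnE big_map big_enum /=.
  rewrite (eq_bigr (fun U => \sum_(W in up nests (up_P V :\ V) U) 1)).
    rewrite nest_childrenE // (big_up_minimals nests_refl anti trans forest) // sum1_card.
    by rewrite (cardsD1 V (up_P V)) Vup.
  move=> U Uch; have [-> _] := IHU U Uch; rewrite sum1_card up_children //.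
  by move: Uch; rewrite nest_childrenE // inE => /andP[].
split=> //; rewrite (big_setD1 V) //= -nvE.
have -> : tree_factorial (nest_tree P V) = nvertices (nest_tree P V) *
    \prod_(m <- map tree_factorial (children (nest_tree P V))) m.
  by case: (nest_tree P V).
congr (_ * _); rewrite nest_treeE // [children _]/=.
rewrite -map_comp big_map big_enum /=.
rewrite -[RHS](big_up_minimals nests_refl anti trans forest) // -nest_childrenE //.
apply: eq_bigr => U Uch; have [_ ->] := IHU U Uch; rewrite up_children //.
by move: Uch; rewrite nest_childrenE // inE => /andP[].
Qed.

Lemma forest_factorial_hooks : forest_factorial (nest_forest P) = hooks nests P.
Proof.
rewrite /forest_factorial /nest_forest big_map big_enum /= nest_rootsE /hooks.
rewrite -[RHS](big_up_minimals nests_refl anti trans forest) //.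
by apply: eq_bigr => V; rewrite inE => /andP[VP _]; have [_ ->] := nest_tree_hooks VP.
Qed.

End HookFormula.
End Nesting.

(** * Moments of a block and of a partition *)

Section Transport.
Variables (m n : nat) (e : 'I_m -> 'I_n).
Hypothesis e_mono : forall i j : 'I_m, (e i < e j)%N = (i < j)%N.
Implicit Types (V W : {set 'I_m}) (P : {set {set 'I_m}}).

Let e_inj : injective e.
Proof.
move=> i j E; apply/val_inj.
case: (ltngtP i j) => // lt; first by have := e_mono i j; rewrite E ltnn lt.
by have := e_mono j i; rewrite E ltnn lt.
Qed.
Let e_le (i j : 'I_m) : (e i <= e j)%N = (i <= j)%N.
Proof. by rewrite leqNgt e_mono -leqNgt. Qed.

Definition image_blocks P : {set {set 'I_n}} :=
  [set [set e i | i in V : {set 'I_m}] | V in P].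

Let imageS_inj : injective (fun V : {set 'I_m} => [set e i | i in V]).
Proof. exact: imset_inj. Qed.

Lemma nests_image V W : nests [set e i | i in V] [set e i | i in W] = nests V W.
Proof.
apply/nestsP/nestsP => H w; last first.
  case/imsetP => v /H[[x xV le1] [y yV le2]] ->.
  by split; [exists (e x) | exists (e y)]; rewrite ?imset_f ?e_le.
move=> wW; have [[_ /imsetP[x xV ->] le1] [_ /imsetP[y yV ->] le2]] := H (e w) (imset_f e wW).
by split; [exists x | exists y]; rewrite // -e_le.
Qed.

Lemma hooks_image P : hooks (@nests n) (image_blocks P) = hooks (@nests m) P.
Proof.
rewrite /hooks big_imset /=; last by move=> ? ? _ _; apply: imageS_inj.
apply: eq_bigr => V VP; rewrite -(card_imset (mem (up (@nests m) P V)) imageS_inj).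
congr #|pred_of_set _|; apply/setP => B; rewrite inE; apply/andP/imsetP.
  case=> /imsetP[W WP ->]; rewrite nests_image => VW; exists W => //.
  by rewrite inE WP.
case=> W; rewrite inE => /andP[WP VW] ->; rewrite nests_image VW.
by split=> //; apply: imset_f.
Qed.

Lemma NC_on_image P : (image_blocks P \in NC_on [set e i | i in setT]) = (P \in NC m).
Proof.
rewrite !inE imset_partition //; congr (_ && _).
apply/noncrossingP/noncrossingP => H.
  move=> V W a b c d VP WP aV bW cV dW ab bc cd; apply: imageS_inj.
  by apply: (H _ _ (e a) (e b) (e c) (e d)); rewrite ?imset_f ?e_mono.
move=> V' W' a' b' c' d' /imsetP[V VP ->] /imsetP[W WP ->].
move=> /imsetP[a aV ->] /imsetP[b bW ->] /imsetP[c cV ->] /imsetP[d dW ->].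
by rewrite !e_mono => ab bc cd; rewrite (H V W a b c d).
Qed.

(** An increasing enumeration of [D] identifies noncrossing partitions of [D] with
    those of an initial segment; this is how the moment-cumulant formula, stated
    for whole words, reaches subwords. *)
Lemma NC_onE : NC_on [set e i | i in setT] = [set image_blocks P | P in NC m].
Proof.
apply/setP => Q; apply/idP/imsetP => [QNC|[P PNC ->]]; last by rewrite NC_on_image.
pose P := [set e @^-1: (B : {set 'I_n}) | B in Q].
have imK B : B \in Q -> e @: (e @^-1: B) = B.
  move=> BQ; have sB : B \subset [set e i | i in setT].
    move: QNC; rewrite inE => /andP[/and3P[/eqP <- _ _] _]; exact: bigcup_sup.
  apply/setP => i; apply/imsetP/idP => [[j]|iB]; first by rewrite inE => ? ->.
  have /imsetP[j _ ij] := subsetP sB i iB.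
  by exists j => //; rewrite inE -ij.
have QE : Q = image_blocks P.
  apply/setP => B; apply/idP/imsetP => [BQ|[V /imsetP[B' BQ ->] ->]].
    by exists (e @^-1: B); rewrite ?imK // imset_f.
  by rewrite imK.
by exists P; rewrite // -NC_on_image -QE.
Qed.

Lemma sum_NC_image (R : nmodType) (G : {set {set 'I_n}} -> R) :
  \sum_(P in NC m) G (image_blocks P) = \sum_(Q in NC_on [set e i | i in setT]) G Q.
Proof. by rewrite NC_onE big_imset //= => P Q _ _; apply: imset_inj. Qed.

End Transport.

Section Blocks.
Variables (R : realType) (A : algType R[i]).
Implicit Types (g : functionals A).

(** The arity of a functional on a block is the cardinal of the block.  Passing
    through the list of arguments allows blocks in different index sets to be
    compared without casts. *)
Definition word_value g (s : seq A) : R[i] := g (size s) [ffun i : 'I_(size s) => nth 0 s i].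

Lemma word_valueE g m (b : {ffun 'I_m -> A}) s : size s = m ->
  (forall i : 'I_m, b i = nth 0 s i) -> g m b = word_value g s.
Proof.
move=> E; subst m => H; congr (g _ _).
by apply/ffunP => i; rewrite ffunE H.
Qed.

Definition block_value g n (a : {ffun 'I_n -> A}) (V : {set 'I_n}) : R[i] :=
  g #|V| (restrict a V).

Lemma block_valueE g n (a : {ffun 'I_n -> A}) (V : {set 'I_n}) :
  block_value g a V = word_value g [seq a i | i <- enum V].
Proof.
apply: word_valueE => [|i]; first by rewrite size_map -cardE.
rewrite ffunE (nth_map (enum_val i)) -?cardE //.
congr (a _); exact: enum_val_nth.
Qed.

Lemma block_value_setT g n (a : {ffun 'I_n -> A}) : block_value g a setT = g n a.
Proof.
rewrite block_valueE; apply/esym/word_valueE => [|i].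
  by rewrite size_map -cardE cardsT card_ord.
rewrite (nth_map i) ?enum_setT -?enumT ?size_enum_ord ?nth_ord_enum //.
Qed.

Lemma sorted_enum_ord n (V : {set 'I_n}) : sorted (fun i j : 'I_n => i < j)%N (enum V).
Proof.
rewrite {1}/enum_mem; apply: sorted_filter; first by move=> x y z; apply: ltn_trans.
rewrite -enumT; have := iota_ltn_sorted 0 n.
by rewrite -val_enum_ord sorted_map.
Qed.

Lemma enum_val_mono n (V : {set 'I_n}) (i j : 'I_#|V|) :
  (enum_val i < enum_val j)%N = (i < j)%N.
Proof.
have lt_mono (k l : 'I_#|V|) : (k < l)%N -> (enum_val k < enum_val l)%N.
  move=> kl; have x0 : 'I_n := enum_val k; rewrite !(enum_val_nth x0).
  have tr : transitive (fun i j : 'I_n => i < j)%N by move=> x y z; apply: ltn_trans.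
  have := @sorted_ltn_nth _ _ tr x0 _ (sorted_enum_ord V) k l.
  by rewrite !inE -cardE; apply.
case: (ltngtP i j) => [/lt_mono->//|/lt_mono/ltnW|/val_inj->]; last by rewrite ltnn.
by rewrite leqNgt => /negPf.
Qed.

Lemma image_enum_val n (V : {set 'I_n}) : [set (enum_val i : 'I_n) | i : 'I_#|V| in setT] = V.
Proof.
apply/setP => x; apply/imsetP/idP => [[i _ ->]|xV]; first exact: enum_valP.
by exists (enum_rank_in xV x); rewrite // enum_rankK_in.
Qed.

(** Both sides evaluate the functional at the same list, since the increasing
    enumeration of [V] carries that of [W] to that of its image. *)
Lemma block_value_restrict g n (a : {ffun 'I_n -> A}) (V : {set 'I_n}) (W : {set 'I_#|V|}) :
  block_value g (restrict a V) W = block_value g a [set enum_val i | i in W].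
Proof.
rewrite !block_valueE; congr word_value.
suff -> : enum [set enum_val i | i in W] = [seq enum_val i | i <- enum W].
  by rewrite -map_comp; apply: eq_map => i; rewrite /= ffunE.
apply: (@irr_sorted_eq _ (fun i j : 'I_n => i < j)%N).
- by move=> x y z; apply: ltn_trans.
- by move=> x; rewrite /= ltnn.
- exact: sorted_enum_ord.
- apply: homo_sorted (sorted_enum_ord W) => i j; by rewrite enum_val_mono.
move=> x; rewrite mem_enum; apply/imsetP/mapP => -[i iW ->]; exists i => //.
  by rewrite mem_enum.
by rewrite -mem_enum.
Qed.

Variables (f h : functionals A).
Hypothesis moment_cumulant : forall n, (0 < n)%N -> forall a : {ffun 'I_n -> A},
     f a = \sum_(P in NC n)
       (forest_factorial (nest_forest P))%:R^-1 * part_functional h P a.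

Lemma block_expansion n (a : {ffun 'I_n -> A}) (V : {set 'I_n}) : V != set0 ->
  block_value f a V = \sum_(Q in NC_on V)
    (hooks (@nests n) Q)%:R^-1 * \prod_(B in Q) block_value h a B.
Proof.
rewrite -card_gt0 => V0; rewrite /block_value moment_cumulant //.
rewrite -[in RHS](image_enum_val V) -sum_NC_image; last exact: enum_val_mono.
apply: eq_bigr => P PNC; rewrite hooks_image; last exact: enum_val_mono.
rewrite forest_factorial_hooks //; congr (_ * _).
rewrite /image_blocks big_imset /=; last by move=> ? ? _ _; apply: imset_inj; apply: enum_val_inj.
by apply: eq_bigr => W WP; rewrite -[RHS]block_value_restrict.
Qed.

End Blocks.

Definition within n (P : {set {set 'I_n}}) (V : {set 'I_n}) := [set B in P | B \subset V].
Definition refines n (P Q : {set {set 'I_n}}) := [forall B in P, exists V in Q, B \subset V].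

Section Refine.
Variables (K : fieldType) (n : nat) (D : {set 'I_n}) (Q : {set {set 'I_n}}).
Hypothesis Q_NC : Q \in NC_on D.
Implicit Types (P : {set {set 'I_n}}) (V B : {set 'I_n}).

Lemma NC_on_cover E P : P \in NC_on E -> cover P = E.
Proof. by rewrite inE => /andP[/and3P[/eqP]]. Qed.

Lemma NC_on_nonempty E P B : P \in NC_on E -> B \in P -> exists i, i \in B.
Proof.
rewrite inE => /andP[/and3P[_ _ P0] _] BP; apply/set0Pn.
by apply: contraNneq P0 => <-.
Qed.

Lemma NC_on_sub E P B : P \in NC_on E -> B \in P -> B \subset E.
Proof. by move=> /NC_on_cover <- BP; apply: bigcup_sup. Qed.

Lemma prod_within E P (G : {set 'I_n} -> K) : P \in NC_on E -> refines P Q ->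
  \prod_(V in Q) \prod_(B in within P V) G B = \prod_(B in P) G B.
Proof.
move=> PNC /forall_inP ref; rewrite (exchange_big_dep (mem P)) /=; last first.
  by move=> V B _; rewrite inE => /andP[].
apply: eq_bigr => B BP; have /exists_inP[V VQ sBV] := ref B BP.
have [i iB] := NC_on_nonempty PNC BP.
rewrite (big_pred1 V) // => W; rewrite inE BP /=.
apply/andP/eqP => [[WQ sBW]|->//].
exact: (eq_block Q_NC WQ VQ (subsetP sBW i iB) (subsetP sBV i iB)).
Qed.

Lemma within_NC P V : P \in NC_on D -> refines P Q -> V \in Q -> within P V \in NC_on V.
Proof.
move=> PNC /forall_inP ref VQ; have := PNC; rewrite !inE.
case/andP=> [/and3P[/eqP cov triv P0] /noncrossingP nc].
have sub : {subset within P V <= P} by move=> B; rewrite inE => /andP[].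
apply/andP; split; last first.
  apply/noncrossingP => B C a b c d BP CP aB bC cB dC.
  exact: (nc B C a b c d (sub _ BP) (sub _ CP)).
apply/and3P; split; last first.
- by apply: contra P0; apply: sub.
- by apply: trivIsetS triv; apply/subsetP.
rewrite eqEsubset; apply/andP; split.
  by apply/bigcupsP => B; rewrite inE => /andP[].
apply/subsetP => i iV; have : i \in cover P by rewrite cov (subsetP (NC_on_sub Q_NC VQ)).
case/bigcupP => B BP iB; apply/bigcupP; exists B => //; rewrite inE BP.
have /exists_inP[W WQ sBW] := ref B BP.
by rewrite (eq_block Q_NC VQ WQ iV (subsetP sBW i iB)).
Qed.

(** Choosing a noncrossing partition inside each block of a noncrossing partition
    [Q] is the same as choosing a noncrossing refinement of [Q]; gluing creates
    no crossing because a crossing between different blocks of [Q] would be one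
    of [Q]. *)
Lemma prod_sum_refine (c : {set {set 'I_n}} -> K) (H : {set 'I_n} -> K) :
  \prod_(V in Q) (\sum_(P in NC_on V) c P * \prod_(B in P) H B)
  = \sum_(P in NC_on D | refines P Q)
      (\prod_(V in Q) c (within P V)) * \prod_(B in P) H B.
Proof.
rewrite (big_distr_big_dep set0).
pose glue (F : {ffun {set 'I_n} -> {set {set 'I_n}}}) := \bigcup_(V in Q) F V.
pose parts P : {ffun {set 'I_n} -> {set {set 'I_n}}} :=
  [ffun V => if V \in Q then within P V else set0].
rewrite [RHS](reindex_onto glue parts) /=; last first.
  move=> P /andP[PNC /forall_inP ref]; apply/setP => B; apply/bigcupP/idP.
    by case=> V VQ; rewrite ffunE VQ inE => /andP[].
  move=> BP; have /exists_inP[V VQ sBV] := ref B BP.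
  by exists V; rewrite // ffunE VQ inE BP.
have glueP (F : {ffun {set 'I_n} -> {set {set 'I_n}}}) : (forall V, V \in Q -> F V \in NC_on V) ->
    [/\ glue F \in NC_on D, refines (glue F) Q & forall V, V \in Q -> within (glue F) V = F V].
  move=> FNC.
  have gE V : V \in Q -> within (glue F) V = F V.
    move=> VQ; apply/setP => B; rewrite inE; apply/andP/idP.
      case=> /bigcupP[W WQ BW] sBV; have [i iB] := NC_on_nonempty (FNC W WQ) BW.
      have iW := subsetP (NC_on_sub (FNC W WQ) BW) i iB.
      by rewrite (eq_block Q_NC VQ WQ (subsetP sBV i iB) iW).
    move=> BF; split; last exact: NC_on_sub (FNC V VQ) BF.
    by apply/bigcupP; exists V.
  suff: glue F \in NC_on D /\ refines (glue F) Q by case.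
  split; last first.
    apply/forall_inP => B /bigcupP[V VQ BF]; apply/exists_inP; exists V => //.
    exact: NC_on_sub (FNC V VQ) BF.
  rewrite inE; apply/andP; split.
    apply/and3P; split.
    - rewrite eqEsubset; apply/andP; split.
        apply/bigcupsP => B /bigcupP[V VQ BF].
        exact: subset_trans (NC_on_sub (FNC V VQ) BF) (NC_on_sub Q_NC VQ).
      rewrite -{1}(NC_on_cover Q_NC); apply/bigcupsP => V VQ.
      rewrite -{1}(NC_on_cover (FNC V VQ)); apply/bigcupsP => B BF.
      by apply: bigcup_sup; apply/bigcupP; exists V.
    - apply/trivIsetP => B C /bigcupP[V VQ BF] /bigcupP[W WQ CF] BC.
      apply/pred0P => i /=; apply/negP => /andP[iB iC].
      have iV := subsetP (NC_on_sub (FNC V VQ) BF) i iB.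
      have iW := subsetP (NC_on_sub (FNC W WQ) CF) i iC.
      have VW := eq_block Q_NC VQ WQ iV iW; subst W.
      by case/eqP: BC; apply: (eq_block (FNC V VQ) BF CF iB iC).
    apply/negP => /bigcupP[V VQ B0].
    by have [x] := NC_on_nonempty (FNC V VQ) B0; rewrite inE.
  apply/noncrossingP => B C a b c' d /bigcupP[V VQ BF] /bigcupP[W WQ CF] aB bC cB dC ab bc cd.
  have sB := subsetP (NC_on_sub (FNC V VQ) BF); have sC := subsetP (NC_on_sub (FNC W WQ) CF).
  have /noncrossingP ncQ : noncrossing Q by move: Q_NC; rewrite inE => /andP[].
  have VW : V = W by apply: (ncQ V W a b c' d); rewrite ?sB ?sC.
  subst W; have /noncrossingP ncF : noncrossing (F V).
    by move: (FNC V VQ); rewrite inE => /andP[].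
  exact: (ncF B C a b c' d).
apply: eq_big => [F|F /pfamilyP[_ /glueP[gNC gref gE]]]; last first.
  rewrite big_split /= -(prod_within _ gNC gref).
  by congr (_ * _); apply: eq_bigr => V VQ; rewrite gE.
apply/pfamilyP/andP => [[/subsetP Fsupp /glueP[gNC gref gE]]|].
  rewrite gNC gref; split=> //; apply/eqP/ffunP => V; rewrite ffunE.
  case: ifP => [/gE//|VQ]; case: (eqVneq (F V) set0) => [->//|VF].
  by have := Fsupp V VF; rewrite [_ \in _]VQ.
case=> /andP[PNC ref] /eqP FE; rewrite -FE; split.
  apply/subsetP => V; apply: contraLR => VQ; by rewrite inE ffunE (negPf VQ) eqxx.
by move=> V VQ; rewrite ffunE VQ; apply: within_NC.
Qed.
End Refine.

(** * Summation over level functions *)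

Section Levels.
Local Open Scope nat_scope.
Variable n : nat.
Implicit Types (l : 'I_n -> nat) (P : {set {set 'I_n}}) (V B C : {set 'I_n}).

Lemma level_relP l (i j : 'I_n) : reflect
  (l i = l j /\ forall m : 'I_n, minn i j <= m -> m <= maxn i j -> l i <= l m)
  (level_rel l i j).
Proof.
apply: (iffP andP) => -[/eqP E H]; split=> //.
  by move=> m m1 m2; apply: (implyP (forallP H m)); rewrite m1.
by apply/forall_inP => m /andP[]; apply: H.
Qed.

Lemma level_rel_equiv l : equivalence_rel (level_rel l).
Proof.
have refl : reflexive (level_rel l).
  move=> i; apply/level_relP; split=> // m; rewrite minnn maxnn => im mi.
  by have -> : m = i by apply/val_inj/eqP; rewrite eqn_leq im mi.
have sym : symmetric (level_rel l).
  suff H i j : level_rel l i j -> level_rel l j i by move=> i j; apply/idP/idP; apply: H.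
  move/level_relP => [E H]; apply/level_relP; rewrite minnC maxnC -E; split=> //.
have trans : transitive (level_rel l).
  move=> j i k /level_relP[E1 H1] /level_relP[E2 H2]; apply/level_relP.
  split=> [|m]; first by rewrite E1.
  rewrite geq_min leq_max => m1 m2.
  case: (boolP ((minn i j <= m) && (m <= maxn i j))) => [/andP[]|nij]; first exact: H1.
  rewrite E1; apply: H2; move: m1 m2 nij; rewrite ?geq_min ?leq_max; lia.
by apply/equivalence_relP; split=> // x y xy z; apply/idP/idP; apply: trans; rewrite // sym.
Qed.

Lemma level_rel_sym l : symmetric (level_rel l).
Proof.
move=> i j; have /equivalence_relP[refl H] := level_rel_equiv l.
by apply/idP/idP => /H <-.
Qed.

Lemma level_pblock l (i j : 'I_n) :
  (j \in pblock (level_partition l) i) = level_rel l i j.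
Proof.
apply: pblock_equivalence_partition; rewrite ?inE // => ? ? ? *.
exact: level_rel_equiv.
Qed.

Lemma level_partitionP l : partition (level_partition l) setT.
Proof. by apply: equivalence_partitionP => ? ? ? *; apply: level_rel_equiv. Qed.

Lemma mem_level_block l V (i j : 'I_n) : V \in level_partition l -> i \in V ->
  (j \in V) = level_rel l i j.
Proof.
move=> VQ iV; rewrite -level_pblock (def_pblock _ VQ iV) //.
by case/and3P: (level_partitionP l).
Qed.

(** If [a] and [c] share a level block and [b] and [d] another one with
    [a < b < c < d], then each level bounds the other from below, so all four
    points have the same level. *)
Lemma level_partition_NC l : level_partition l \in NC_on setT.
Proof.
rewrite inE level_partitionP; apply/noncrossingP => V W a b c d VQ WQ aV bW cV dW ab bc cd.
have triv : trivIset (level_partition l) by case/and3P: (level_partitionP l).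
suff bV : b \in V by rewrite -(def_pblock triv VQ bV) (def_pblock triv WQ bW).
have := cV; have := dW; rewrite (mem_level_block _ VQ aV) (mem_level_block _ WQ bW).
move=> /level_relP[lbd Hbd] /level_relP[lac Hac].
have lab : l a <= l b by apply: Hac; move: ab bc; clear; lia.
have lbc : l b <= l c by apply: Hbd; move: bc cd; clear; lia.
rewrite (mem_level_block _ VQ aV); apply/level_relP; split.
  by apply/eqP; rewrite eqn_leq lab lac lbc.
move=> m m1 m2; apply: Hac; move: m1 m2 ab bc; clear; lia.
Qed.

Definition compatible P l := [forall B in P, forall i in B, forall j in B, level_rel l i j].

Lemma refines_level E P l : P \in NC_on E ->
  refines P (level_partition l) = compatible P l.
Proof.
move=> PNC; apply: eq_forallb_in => B BP.
have [x xB] := NC_on_nonempty PNC BP.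
apply/exists_inP/forall_inP => [[V VQ /subsetP BV] i iB|H].
  by apply/forall_inP => j jB; rewrite -(mem_level_block _ VQ) ?BV.
exists (pblock (level_partition l) x).
  by apply: pblock_mem; rewrite (cover_partition (level_partitionP l)).
by apply/subsetP => y yB; rewrite level_pblock; apply: (forall_inP (H x xB)).
Qed.

End Levels.

Section SumLevels.
Variables (K : numFieldType) (n N : nat) (P : {set {set 'I_n}}).
Hypothesis P_NC : P \in NC n.
Implicit Types (B C V : {set 'I_n}).
Local Notation levels := {ffun 'I_n -> 'I_N.+1}.
Local Notation block_levels := {ffun {set 'I_n} -> 'I_N.+1}.

Let triv : trivIset P.
Proof. by move: P_NC; rewrite inE => /andP[/and3P[]]. Qed.
Let mem_pb i : pblock P i \in P.
Proof.
by apply: pblock_mem; move: P_NC; rewrite inE => /andP[/cover_partition->].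
Qed.
Let in_pb i : i \in pblock P i.
Proof. by rewrite mem_pblock; move: P_NC; rewrite inE => /andP[/cover_partition->]. Qed.
Let pbE B i : B \in P -> i \in B -> pblock P i = B.
Proof. exact: def_pblock. Qed.

(** A block with one point under the arc from [i] to [j] cannot leave the hull of
    [B] without crossing it. *)
Lemma nests_between B C (i j m : 'I_n) : B \in P -> C \in P -> i \in B -> j \in B ->
  m \in C -> (i <= m)%N -> (m <= j)%N -> nests B C.
Proof.
move=> BP CP iB jB mC im mj; case: (eqVneq B C) => [->|/eqP BC]; first exact: nests_refl.
have nc : noncrossing P by move: P_NC; rewrite inE => /andP[].
move/noncrossingP: nc => nc.
have ne u v : u \in B -> v \in C -> (u : nat) != v.
  by move=> uB vC; apply/eqP => /val_inj uv; apply: BC; apply: (eq_block P_NC BP CP uB); rewrite uv.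
have im' : (i < m)%N by rewrite ltn_neqAle ne.
have mj' : (m < j)%N by rewrite ltn_neqAle eq_sym ne.
apply/nestsP => w wC; split.
  case: (leqP i w) => [iw|wi]; first by exists i.
  by case: BC; apply/esym; apply: (nc C B w i m j).
case: (leqP w j) => [wj|jw]; first by exists j.
by case: BC; apply: (nc B C i m j w).
Qed.

(** [spread] and [collect] identify the level functions compatible with [P] with
    the weakly increasing functions on the nesting forest of [P]. *)
Definition spread (g : block_levels) : levels := [ffun i => g (pblock P i)].
Definition collect (l : levels) : block_levels :=
  [ffun B => if B \in P then (if [pick i in B] is Some i then l i else ord0) else ord0].

Lemma spreadE g B i : B \in P -> i \in B -> spread g i = g B.
Proof. by move=> BP iB; rewrite ffunE (pbE BP iB). Qed.

Lemma collectE (l : levels) B i : compatible P (levels_nat l) -> B \in P -> i \in B ->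
  collect l B = l i.
Proof.
move=> /forall_inP cl BP iB; rewrite ffunE BP; case: pickP => [j jB|/(_ i)]; last by rewrite iB.
have /level_relP[E _] := forall_inP (forall_inP (cl B BP) j jB) i iB.
exact: val_inj.
Qed.

Lemma collectK l : compatible P (levels_nat l) -> spread (collect l) = l.
Proof. by move=> cl; apply/ffunP => i; rewrite ffunE (collectE cl (mem_pb i) (in_pb i)). Qed.

Lemma collect_level_map l : compatible P (levels_nat l) ->
  level_map (@nests n) N.+1 P (collect l).
Proof.
move=> cl; apply/level_mapP; split=> [B _|B /negPf BP|B C BP CP BC].
- exact: ltn_ord.
- by rewrite ffunE BP.
have [w wC] := NC_on_nonempty P_NC CP.
move/nestsP/(_ w wC): BC => [[x xB xw] [y yB wy]].
rewrite (collectE cl BP xB) (collectE cl CP wC).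
have /forall_inP/(_ B BP)/forall_inP/(_ x xB)/forall_inP/(_ y yB)/level_relP[_] := cl.
by apply; rewrite ?geq_min ?leq_max ?xw ?wy ?orbT.
Qed.

(** A point between two points of [B] lies in a block nested in [B], whose level
    is at least that of [B]. *)
Lemma spread_compatible g : level_map (@nests n) N.+1 P g ->
  compatible P (levels_nat (spread g)).
Proof.
case/level_mapP => _ _ gle; apply/forall_inP => B BP.
have key (i j : 'I_n) : i \in B -> j \in B -> (i <= j)%N -> level_rel (levels_nat (spread g)) i j.
  move=> iB jB ij; apply/level_relP; rewrite /levels_nat !(spreadE g BP) //.
  split=> // m; rewrite (minn_idPl ij) (maxn_idPr ij) => im mj.
  rewrite [spread g m]ffunE; apply: (gle B _ BP (mem_pb m)).
  exact: (nests_between BP (mem_pb m) iB jB (in_pb m) im mj).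
apply/forall_inP => i iB; apply/forall_inP => j jB.
by case: (leqP i j) => [ij|/ltnW ji]; [exact: key | rewrite level_rel_sym key].
Qed.

Lemma spreadK g : level_map (@nests n) N.+1 P g -> collect (spread g) = g.
Proof.
move=> gm; have cl := spread_compatible gm.
case/level_mapP: gm => _ g0 _; apply/ffunP => B; case: (boolP (B \in P)) => BP.
  have [i iB] := NC_on_nonempty P_NC BP.
  by rewrite (collectE cl BP iB) (spreadE _ BP).
by rewrite ffunE (negPf BP) g0.
Qed.

(** A block [C] nested in [B] lies in the same level block as [B] exactly when it
    has the same level, so the hooks computed inside the blocks of the level
    partition are the hooks computed inside the level sets. *)
Lemma hooks_within g : level_map (@nests n) N.+1 P g ->
  \prod_(V in level_partition (levels_nat (spread g)))
      (hooks (@nests n) (within P V))%:R^-1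
  = \prod_(B in P) #|same_level_up (@nests n) P g B|%:R^-1 :> K.
Proof.
move=> gm; have cl := spread_compatible gm; set l := levels_nat _ in cl *.
have QNC := level_partition_NC l.
rewrite -(prod_within QNC _ P_NC); last by rewrite (refines_level _ P_NC).
apply: eq_bigr => V VQ; rewrite /hooks natr_prod -prodfV.
apply: eq_bigr => B; rewrite inE => /andP[BP sBV].
congr (#|pred_of_set _|%:R^-1); apply/setP => C; rewrite !inE.
case CP: (C \in P) => //=; case BC: (nests B C); rewrite ?andbF ?andbT //=.
have [b bB] := NC_on_nonempty P_NC BP; have [c cC] := NC_on_nonempty P_NC CP.
apply/idP/eqP => [/subsetP sCV|gE].
  have : level_rel l b c by rewrite -(mem_level_block _ VQ (subsetP sBV b bB)) sCV.
  case/level_relP=> E _; apply: val_inj => /=.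
  by have := E; rewrite /l /levels_nat (spreadE g BP bB) (spreadE g CP cC) => ->.
apply/subsetP => w wC; rewrite (mem_level_block _ VQ (subsetP sBV b bB)).
move/nestsP/(_ w wC): BC => [[x xB xw] [y yB wy]].
have lB z : z \in B -> l z = g B by move=> zB; rewrite /l /levels_nat (spreadE g BP).
have clB z t : z \in B -> t \in B -> level_rel l z t.
  by move=> zB tB; apply: (forall_inP (forall_inP (forall_inP cl B BP) z zB)).
have lw : l w = g B by rewrite /l /levels_nat (spreadE g CP wC) gE.
apply/level_relP; split=> [|m]; first by rewrite lw lB.
rewrite lB // geq_min leq_max => m1 m2.
have /level_relP[_ H1] := clB b y bB yB; have /level_relP[_ H2] := clB b x bB xB.
rewrite -(lB b bB).
case: (boolP ((minn b y <= m) && (m <= maxn b y)))%N => [/andP[]|nby]; first exact: H1.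
by apply: H2; move: m1 m2 nby; rewrite ?geq_min ?leq_max; move: xw wy; clear; lia.
Qed.

Lemma sum_compatible_levels :
  \sum_(l : levels | refines P (level_partition (levels_nat l)))
     \prod_(V in level_partition (levels_nat l)) (hooks (@nests n) (within P V))%:R^-1
  = N.+1%:R ^+ #|P| / (hooks (@nests n) P)%:R :> K.
Proof.
have trans U V W (_ : U \in P) (_ : V \in P) (_ : W \in P) : nests U V -> nests V W -> nests U W
  := @nests_trans n V U W.
rewrite -(sum_level_maps (@nests_refl n) (nests_anti P_NC) trans
  (nests_forest P_NC) K (leqnn N.+1)) //.
rewrite (reindex_onto spread collect) /=; last first.
  by move=> l; rewrite (refines_level _ P_NC); apply: collectK.
apply: eq_big => [g|g /andP[]].
  rewrite (refines_level _ P_NC); apply/andP/idP => [[cl /eqP <-]|gm].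
    exact: collect_level_map.
  by rewrite spread_compatible // spreadK.
rewrite (refines_level _ P_NC) => cl /eqP gE; apply: hooks_within.
by rewrite -gE; apply: collect_level_map.
Qed.

End SumLevels.

Section MomentPowers.
Variables (R : realType) (A : algType R[i]) (f h : functionals A).
Hypothesis moment_cumulant : forall n, (0 < n)%N -> forall a : {ffun 'I_n -> A},
     f a = \sum_(P in NC n)
       (forest_factorial (nest_forest P))%:R^-1 * part_functional h P a.

(** The left-hand side is the value of the convolution power [N.+1] of the moments;
    expanding each level block into cumulants and exchanging the sums leaves, for
    each [P], the sum over the level functions compatible with [P]. *)
Lemma sum_levels_moments n N (a : {ffun 'I_n -> A}) :
  \sum_(l : {ffun 'I_n -> 'I_N.+1}) part_functional f (level_partition (levels_nat l)) a
  = \sum_(P in NC n) N.+1%:R ^+ #|P| / (hooks (@nests n) P)%:R * part_functional h P a.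
Proof.
transitivity (\sum_(l : {ffun 'I_n -> 'I_N.+1})
  \sum_(P in NC n | refines P (level_partition (levels_nat l)))
    (\prod_(V in level_partition (levels_nat l)) (hooks (@nests n) (within P V))%:R^-1)
    * part_functional h P a).
  apply: eq_bigr => l _; have QNC := level_partition_NC (levels_nat l).
  rewrite -(prod_sum_refine QNC (fun P => (hooks (@nests n) P)%:R^-1) (block_value h a)).
  apply: eq_bigr => V VQ; apply: (block_expansion moment_cumulant).
  by have [x xV] := NC_on_nonempty QNC VQ; apply/set0Pn; exists x.
rewrite (exchange_big_dep (mem (NC n))) /=; last by move=> ? ? _ /andP[].
apply: eq_bigr => P PNC; rewrite -(sum_compatible_levels _ N PNC) mulr_suml.
by apply: eq_bigl => l; rewrite PNC.
Qed.
End MomentPowers.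

(** * Extraction of the linear coefficient *)

Lemma level_partition_mono n l l' :
  (forall i j : 'I_n, (l i <= l j)%N = (l' i <= l' j)%N) ->
  level_partition l = level_partition l'.
Proof.
move=> H; apply: eq_imset => i; apply/setP => j; rewrite !inE /= /level_rel.
rewrite !eqn_leq !H; congr (_ && _); apply: eq_forallb => m.
by rewrite H.
Qed.

Lemma surjection_leq_card (T : finType) k (f : T -> 'I_k) :
  [forall c, exists v, f v == c] -> (k <= #|T|)%N.
Proof.
move=> /forallP fsurj; rewrite -[k in (k <= _)%N]card_ord -!cardsT.
have <- : [set f v | v in setT] = setT; last exact: leq_imset_card.
apply/setP => c; rewrite inE; have /existsP[v /eqP <-] := fsurj c.
by rewrite imset_f.
Qed.

Section Surjective.
Variables (K : pzRingType) (n : nat) (G : {set {set 'I_n}} -> K).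
Hypothesis n_gt0 : (0 < n)%N.

Definition surjective_sum k :=
  \sum_(l : {ffun 'I_n -> 'I_k} | surjective_levels l) G (level_partition (levels_nat l)).

(** The level partition depends only on the order of the levels, so that levels in
    [J] may be renumbered increasingly. *)
Lemma sum_levels_image k (J : {set 'I_k}) :
  \sum_(l : {ffun 'I_n -> 'I_k} | [set l i | i in setT] == J)
     G (level_partition (levels_nat l)) = surjective_sum #|J|.
Proof.
have [->|[x0 x0J]] := set_0Vmem J.
  rewrite big_pred0 => [|l]; last first.
    apply/eqP => /setP/(_ (l (Ordinal n_gt0))); rewrite inE.
    by rewrite imset_f.
  rewrite /surjective_sum big_pred0 // => l.
  have : (0 < #|@set0 'I_k|)%N by apply: leq_ltn_trans (ltn_ord (l (Ordinal n_gt0))).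
  by case/card_gt0P => x; rewrite inE.
rewrite (reindex_onto (fun l : {ffun 'I_n -> 'I_#|J|} => [ffun i => enum_val (l i)])
  (fun l => [ffun i => enum_rank_in x0J (l i)])) /=; last first.
  move=> l /eqP imJ; apply/ffunP => i; rewrite !ffunE enum_rankK_in //.
  by rewrite -imJ imset_f.
apply: eq_big => l.
  have -> : [ffun i => enum_rank_in x0J ([ffun i0 => enum_val (l i0)] i)] == l.
    by apply/eqP/ffunP => i; rewrite !ffunE enum_valK_in.
  rewrite andbT; apply/eqP/forallP => [imJ c|lsurj].
    have : enum_val c \in J by apply: enum_valP.
    rewrite -{2}imJ => /imsetP[i _]; rewrite ffunE => /enum_val_inj cE.
    by apply/existsP; exists i; rewrite cE.
  apply/setP => x; apply/imsetP/idP => [[i _ ->]|xJ]; first by rewrite ffunE enum_valP.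
  have /existsP[i /eqP li] := lsurj (enum_rank_in x0J x).
  by exists i => //; rewrite ffunE li enum_rankK_in.
move=> _; congr G; apply: level_partition_mono => i j.
by rewrite /levels_nat !ffunE leqNgt enum_val_mono -leqNgt.
Qed.

Lemma sum_levels_binomial k :
  \sum_(l : {ffun 'I_n -> 'I_k}) G (level_partition (levels_nat l))
  = \sum_(j < n.+1) surjective_sum j *+ 'C(k, j).
Proof.
pose im (l : {ffun 'I_n -> 'I_k}) := [set l i | i in setT].
have im_le l : (#|im l| < n.+1)%N.
  by rewrite ltnS (leq_trans (leq_imset_card _ _)) // cardsT card_ord.
rewrite (partition_big (fun l => Ordinal (im_le l)) xpredT) //=.
apply: eq_bigr => j _.
rewrite (partition_big im (fun J => #|J| == j)) /=; last first.
  by move=> l; rewrite -val_eqE.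
rewrite (eq_bigr (fun _ => surjective_sum j)) => [|J /eqP cJ].
  by rewrite sumr_const -cardsE card_draws card_ord.
rewrite -cJ -sum_levels_image; apply: eq_bigl => l.
by rewrite -val_eqE /= -/(im l) -cJ; apply: andb_idl => /eqP->.
Qed.

End Surjective.

Section BinomialPoly.
Variable K : numFieldType.

Definition binomial_poly j : {poly K} :=
  (j`!)%:R^-1 *: \prod_(i < j) ('X - (i%:R)%:P).

Lemma horner_binomial_poly j k : (binomial_poly j).[k%:R] = 'C(k, j)%:R.
Proof.
have E : \prod_(i < j) (k%:R - i%:R) = (k ^_ j)%:R :> K.
  elim: j => [|j IH]; first by rewrite big_ord0.
  rewrite big_ord_recr /= IH ffactnSr natrM.
  case: (leqP j k) => [lejk|ltkj]; first by rewrite natrB.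
  by rewrite ffact_small // !mul0r.
rewrite hornerZ horner_prod.
under eq_bigr => i _ do rewrite hornerXsubC.
rewrite E -bin_ffact natrM mulrC mulfK // pnatr_eq0 -lt0n fact_gt0 //.
Qed.

Lemma coef1_binomial_poly j : (binomial_poly j)`_1 = if j is j'.+1 then (-1) ^+ j' / j%:R else 0.
Proof.
rewrite coefZ; case: j => [|j]; first by rewrite big_ord0 coefC mulr0.
rewrite big_ord_recl subr0 coefXM /= -horner_coef0 horner_prod.
under eq_bigr => i _ do rewrite hornerXsubC sub0r.
rewrite prodrN card_ord -natr_prod.
have -> : (\prod_(i < j) bump 0 i)%N = j`!.
  by rewrite fact_prod big_add1 /= big_mkord; apply: eq_bigr.
rewrite mulrCA factS natrM invfM -mulrA mulVf ?mulr1 //.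
by rewrite pnatr_eq0 -lt0n fact_gt0.
Qed.

Lemma poly_eq_nat (p q : {poly K}) : (forall k, p.[k.+1%:R] = q.[k.+1%:R]) -> p = q.
Proof.
move=> H; apply/eqP; rewrite -subr_eq0; apply/negP => /negP pq0.
pose rs : seq K := [seq i.+1%:R | i <- iota 0 (size (p - q))].
have rs_root : all (root (p - q)) rs.
  by apply/allP => _ /mapP[k _ ->]; rewrite rootE hornerD hornerN H subrr.
have rs_uniq : uniq rs.
  by rewrite map_inj_uniq ?iota_uniq // => i j /eqP; rewrite eqr_nat eqSS => /eqP.
by have := max_poly_roots pq0 rs_root rs_uniq; rewrite size_map size_iota ltnn.
Qed.

End BinomialPoly.

Lemma size_vertices s : size (vertices s) = nvertices s.
Proof.
elim/ptree_mem_ind: s => ts IH /=; congr _.+1; rewrite size_map.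
elim: ts 0%N IH => //= t ts IHts c IH.
rewrite size_cat size_map IH ?mem_head // IHts // => u uts.
by apply: IH; rewrite inE uts orbT.
Qed.

Lemma murua_count_eq0 k s : (nvertices s < k)%N -> murua_count k s = 0%N.
Proof.
move=> ltk; apply/eqP; rewrite cards_eq0 -subset0; apply/subsetP => f.
rewrite inE => /andP[/surjection_leq_card lek _].
have : (#|{: vertex s}| <= nvertices s)%N.
  rewrite -size_vertices cardT -(size_map val).
  apply: uniq_leq_size; last by move=> _ /mapP[v _ ->]; apply: valP.
  by rewrite (map_inj_uniq val_inj) enum_uniq.
by move/(leq_trans lek); rewrite leqNgt ltk.
Qed.

(** Depth is an increasing labelling, so the partition of a tree is a level
    partition. *)
Lemma tree_partition_NC n (t : schroeder_tree n) : tree_partition t \in NC n.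
Proof.
have inc : increasing t size.
  move=> p q _ _ /prefixP[r ->]; rewrite size_cat.
  by case: r => [|x r]; rewrite ?cats0 ?eqxx //= addnS leq_addr.
by rewrite (level_treeP (l := fun i => size (nth [::] (sectors t) i)) inc) // level_partition_NC.
Qed.

Lemma sum_nat_truncate (K : nmodType) (F : nat -> K) m p : (m <= p)%N ->
  (forall j, (m < j)%N -> F j = 0) ->
  \sum_(1 <= j < m.+1) F j = \sum_(1 <= j < p.+1) F j.
Proof.
move=> lemp F0; rewrite [RHS](@big_cat_nat _ _ _ m.+1) //=.
by rewrite [X in _ + X]big_nat_cond [X in _ + X]big1 ?addr0 // => j /andP[/andP[/F0]].
Qed.

Section Inversion.
Variables (R : realType) (A : algType R[i]) (f h : functionals A).
Hypothesis moment_cumulant : forall n, (0 < n)%N -> forall a : {ffun 'I_n -> A},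
     f a = \sum_(P in NC n)
       (forest_factorial (nest_forest P))%:R^-1 * part_functional h P a.
Variables (n : nat) (a : {ffun 'I_n -> A}).
Hypothesis n_gt0 : (0 < n)%N.
Let G P := part_functional f P a.

(** Two polynomials agree at all positive integers: one counts level functions by
    their image, the other by the cumulants.  Their coefficients of degree one
    are the two sides. *)
Lemma cumulant_surjective_sums :
  h a = \sum_(1 <= j < n.+1) (-1) ^+ j.+1 / j%:R * surjective_sum G j.
Proof.
(* [p] interpolates the moment side and [q] the cumulant side. *)
pose p : {poly R[i]} := \sum_(j < n.+1) surjective_sum G j *: binomial_poly _ j.
pose q : {poly R[i]} := \sum_(P in NC n)
  ((hooks (@nests n) P)%:R^-1 * part_functional h P a) *: 'X^#|P|.
have pq : p = q.
  apply: poly_eq_nat => N; rewrite !horner_sum.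
  transitivity (\sum_(l : {ffun 'I_n -> 'I_N.+1}) G (level_partition (levels_nat l))).
    rewrite sum_levels_binomial //; apply: eq_bigr => j _.
    by rewrite hornerZ horner_binomial_poly mulr_natr.
  rewrite (sum_levels_moments moment_cumulant); apply: eq_bigr => P _.
  by rewrite hornerZ hornerXn [RHS]mulrC mulrA.
have := congr1 (fun r : {poly R[i]} => r`_1) pq; rewrite !coef_sum.
rewrite big_ord_recl /= coefZ coef1_binomial_poly mulr0 add0r.
rewrite (bigD1 [set setT]) /=; last first.
  rewrite inE; apply/andP; split; last first.
    by apply/noncrossingP => V W ? ? ? ? /set1P-> /set1P->.
  apply/and3P; split; first by rewrite cover1.
    exact: trivIset1.
  by rewrite inE eq_sym; apply/set0Pn; exists (Ordinal n_gt0).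
rewrite [X in _ + X]big1 ?addr0 => [|P /andP[PNC PT]]; last first.
  rewrite coefZ coefXn; case: eqP => [/esym/eqP/cards1P[V PE]|_]; last by rewrite mulr0.
  case/eqP: PT; rewrite PE -(NC_on_cover PNC) PE.
  by rewrite cover1.
rewrite coefZ coefXn cards1 eqxx mulr1 /part_functional big_set1.
rewrite -/(block_value h a setT) block_value_setT.
have -> : hooks (@nests n) [set setT] = 1%N.
  rewrite /hooks big_set1 -(cards1 ([set: 'I_n] : {set 'I_n})); congr #|pred_of_set _|.
  by apply/setP => V; rewrite !inE; case: eqP => //= ->; rewrite nests_refl.
rewrite invr1 mul1r => <-; rewrite big_add1 big_mkord /=; apply: eq_bigr => j _.
by rewrite coefZ coef1_binomial_poly mulrC /= !exprS !mulN1r opprK.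
Qed.

(** The bijection with labelled trees turns the surjective sums into Murua counts.
    The two ranges of summation differ, but beyond [n] there are no level
    functions onto [j] levels and beyond the number of vertices no strict
    surjections. *)
Lemma cumulant_trees :
  h a = \sum_(t : schroeder_tree n) ratr (murua (skeleton t)) * G (tree_partition t).
Proof.
rewrite cumulant_surjective_sums.
under eq_bigr => j _ do rewrite /surjective_sum -sum_trees_levels // mulr_sumr.
rewrite exchange_big /=; apply: eq_bigr => t _.
under eq_bigr => j _ do rewrite mulrA.
rewrite -mulr_suml; congr (_ * _); rewrite /murua rmorph_sum /=.
have E j : ratr ((-1) ^+ j.+1 / j%:R * (murua_count j (skeleton t))%:R)
   = (-1) ^+ j.+1 / j%:R * (murua_count j (skeleton t))%:R :> R[i].
  by rewrite rmorphM /= fmorph_div rmorphXn /= rmorphN1 !ratr_nat.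
under [RHS]eq_bigr => j _ do rewrite E.
pose F j : R[i] := (-1) ^+ j.+1 / j%:R * (murua_count j (skeleton t))%:R.
rewrite -/F (sum_nat_truncate (F := F) (leq_maxl n (nvertices (skeleton t)))).
  rewrite -(sum_nat_truncate (F := F) (leq_maxr n (nvertices (skeleton t)))) // => j ltj.
  by rewrite /F murua_count_eq0 // mulr0.
move=> j ltj; rewrite /F murua_count_levels //.
rewrite (_ : [set _ | _] = set0) ?cards0 ?mulr0 //.
apply/setP => l; rewrite !inE; apply/negP => /andP[/surjection_leq_card].
by rewrite card_ord leqNgt ltj.
Qed.

End Inversion.

Theorem corollary5p12 (R : realType) (A : algType R[i]) (phi : {scalar A})
    (phi1 : phi 1 = 1) (h : functionals A)
    (hh : monotone_cumulants phi h)
    (n : nat) (n_gt0 : (0 < n)%N) (a : {ffun 'I_n -> A}) :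
  h n a = \sum_(P in NC n) ratr (alpha P) * part_functional (moments phi) P a.
Proof.
rewrite (cumulant_trees hh.2 a n_gt0).
rewrite (partition_big (@tree_partition n) (mem (NC n))) /=; last first.
  by move=> t _; apply: tree_partition_NC.
apply: eq_bigr => P _; rewrite /alpha rmorph_sum mulr_suml.
by apply: eq_bigr => t /eqP->.
Qed.
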